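(* Let $(M,g)$ be a Riemannian manifold. Suppose that $G\leq\mathrm{Conf}(M,g)$ is a subgroup of conformal automorphisms that acts properly on $M$. Then there exists on $M$ a Riemannian metric $h$ conformal to $g$ such that $G\leq\mathrm{Iso}(M,h)$.
   Context: $\mathrm{Conf}(M,g)$ is the group of diffeomorphisms $\alpha$ of $M$ with $\alpha^*g=f\cdot g$ for some $f\in C^\infty(M,\mathbb{R}^{>0})$; $\mathrm{Iso}(M,h)$ is the group of isometries of $h$. The metric $h$ is conformal to $g$ if $h=v\cdot g$ with $v\in C^\infty(M,\mathbb{R}^{>0})$. $G$ is considered as a Lie group acting smoothly on $M$. *)

(* Defs.v *)
From HB Require Import structures.
From mathcomp Require Import all_boot all_order all_algebra.
From mathcomp Require Import all_classical all_reals all_analysis.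
Set Implicit Arguments.
Unset Strict Implicit.
Unset Printing Implicit Defensive.
Import Order.TTheory GRing.Theory Num.Theory.
Import numFieldNormedType.Exports.
Local Open Scope classical_set_scope.
Local Open Scope ring_scope.

(* C^k and C^oo on an open subset U of R^n, by iterated partial derivatives. *)
Fixpoint Ck_on (R : realType) n (k : nat) (U : set 'rV[R]_n)
    (f : 'rV[R]_n -> R) : Prop :=
  (forall x, U x -> {for x, continuous f}) /\
  (if k is k'.+1 then
     forall i : 'I_n,
       (forall x, U x -> derivable f x (delta_mx 0 i)) /\
       Ck_on k' U (fun x => 'D_(delta_mx 0 i) f x)
   else True).

Definition smooth_fun_on (R : realType) n (U : set 'rV[R]_n)
    (f : 'rV[R]_n -> R) : Prop :=
  forall k, Ck_on k U f.

Definition smooth_on (R : realType) n m (U : set 'rV[R]_n)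
    (f : 'rV[R]_n -> 'rV[R]_m) : Prop :=
  forall j, smooth_fun_on U (fun x => f x 0 j).

(* A homeomorphism from an open set of M onto an open set of R^n. Both
   directions are total functions, meaningful only on chart_dom and on its
   image. If M is empty there is no chart, and the empty atlas covers M. *)
Record chart (R : realType) (n : nat) (M : topologicalType) := Chart {
  chart_dom : set M;
  chart_fun :> M -> 'rV[R]_n;
  chart_inv : 'rV[R]_n -> M;
  chart_dom_open : open chart_dom;
  chart_img_open : open (chart_fun @` chart_dom);
  chart_funK : forall x, chart_dom x -> chart_inv (chart_fun x) = x;
  chart_fun_continuous :
    forall x, chart_dom x -> {for x, continuous chart_fun};
  chart_inv_continuous :
    forall x, chart_dom x -> {for chart_fun x, continuous chart_inv}
}.

HB.mixin Record isManifold (R : realType) (n : nat) M of Topological M := {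
  atlas : set (chart R n M);
  atlas_cover : forall x : M, exists2 c, atlas c & chart_dom c x;
  atlas_compatible : forall c c', atlas c -> atlas c' ->
    smooth_on (c @` (chart_dom c `&` chart_dom c')) (c' \o chart_inv c);
  manifold_hausdorff : hausdorff_space M;
  manifold_second_countable : @second_countable M
}.

#[short(type="manifoldType")]
HB.structure Definition Manifold (R : realType) (n : nat) :=
  {M of Topological M & isManifold R n M}.

Section Smoothness.
Context {R : realType}.

Definition smooth_fun n (M : manifoldType R n) (f : M -> R) : Prop :=
  forall c : chart R n M, atlas c ->
    smooth_fun_on (c @` chart_dom c) (f \o chart_inv c).

Definition smooth_map n m (M : manifoldType R n) (N : manifoldType R m)
    (f : M -> N) : Prop :=
  continuous f /\
  forall (c : chart R n M) (c' : chart R m N), atlas c -> atlas c' ->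
    smooth_on (c @` (chart_dom c `&` f @^-1` chart_dom c'))
              (c' \o f \o chart_inv c).

(* Smoothness of f as a map from the product manifold M1 x M2, read in the
   product charts (x, y) |-> row_mx (c1 x) (c2 y). *)
Definition smooth_map2 n1 n2 m (M1 : manifoldType R n1)
    (M2 : manifoldType R n2) (N : manifoldType R m)
    (f : M1 -> M2 -> N) : Prop :=
  continuous (fun p : M1 * M2 => f p.1 p.2) /\
  forall (c1 : chart R n1 M1) (c2 : chart R n2 M2) (c : chart R m N),
    atlas c1 -> atlas c2 -> atlas c ->
    smooth_on
      [set row_mx (c1 p.1) (c2 p.2) | p in
        [set p | [/\ chart_dom c1 p.1, chart_dom c2 p.2 &
                     chart_dom c (f p.1 p.2)]]]
      (fun u => c (f (chart_inv c1 (lsubmx u)) (chart_inv c2 (rsubmx u)))).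

Definition diffeomorphism n (M : manifoldType R n) (f : M -> M) : Prop :=
  smooth_map f /\
  exists2 f', smooth_map f' & cancel f f' /\ cancel f' f.

End Smoothness.

HB.mixin Record isLieGroup (R : realType) (k : nat) G
    of Manifold R k G & Group G := {
  mulg_smooth : smooth_map2 (fun a b : G => (a * b)%g);
  invg_smooth : smooth_map (fun a : G => a^-1%g)
}.

#[short(type="lieGroupType")]
HB.structure Definition LieGroup (R : realType) (k : nat) :=
  {G of Manifold R k G & Group G & isLieGroup R k G}.

Section Riemannian.
Context {R : realType} {n : nat}.

Definition chart_at (M : manifoldType R n) (x : M) : chart R n M :=
  s2val (cid2 (atlas_cover x)).

(* The tangent space at x, identified with R^n through the chart chart_at x. *)
Definition tangent (M : manifoldType R n) (x : M) := 'rV[R]_n.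

(* The differential T_x M -> T_(f x) M. *)
Definition tangent_map (M : manifoldType R n) (f : M -> M) (x : M)
    (v : tangent x) : tangent (f x) :=
  v *m jacobian (chart_at (f x) \o f \o chart_inv (chart_at x))
                (chart_at x x).

(* The i-th coordinate vector field of the chart c, at the point x. *)
Definition coord_vector (M : manifoldType R n) (c : chart R n M) (i : 'I_n)
    (x : M) : tangent x :=
  delta_mx 0 i *m jacobian (chart_at x \o chart_inv c) (c x).

Record riemannian_metric (M : manifoldType R n) := RiemannianMetric {
  metric :> forall x : M, tangent x -> tangent x -> R;
  metric_sym : forall x (v w : tangent x), metric v w = metric w v;
  metric_linear : forall x (w : tangent x),
    scalar (fun v : 'rV[R]_n => @metric x v w);
  metric_pos : forall x (v : tangent x), v != 0 :> 'rV[R]_n -> 0 < metric v v;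
  metric_smooth : forall c : chart R n M, atlas c -> forall i j : 'I_n,
    smooth_fun_on (c @` chart_dom c)
      ((fun x => metric (coord_vector c i x) (coord_vector c j x))
         \o chart_inv c)
}.

Definition smooth_pos (M : manifoldType R n) (f : M -> R) : Prop :=
  smooth_fun f /\ forall x, 0 < f x.

(* The tensor a^*g. *)
Definition pullback (M : manifoldType R n) (a : M -> M)
    (g : riemannian_metric M) (x : M) (v w : tangent x) : R :=
  g (a x) (tangent_map a v) (tangent_map a w).

Definition Conf (M : manifoldType R n) (g : riemannian_metric M) :
    set (M -> M) :=
  [set a | diffeomorphism a /\
    exists2 f : M -> R, smooth_pos f &
      forall (x : M) (v w : tangent x), pullback a g v w = f x * g x v w].

Definition Iso (M : manifoldType R n) (h : riemannian_metric M) :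
    set (M -> M) :=
  [set a | diffeomorphism a /\
    forall (x : M) (v w : tangent x), pullback a h v w = h x v w].

Definition conformal_to (M : manifoldType R n)
    (h g : riemannian_metric M) : Prop :=
  exists2 f : M -> R, smooth_pos f &
    forall (x : M) (v w : tangent x), h x v w = f x * g x v w.

End Riemannian.

(* act identifies the abstract group G with a subgroup, under composition, of
   the group S of transformations of M. *)
Definition subgroup_via (G : groupType) (M : Type) (act : G -> M -> M)
    (S : set (M -> M)) : Prop :=
  [/\ injective act, act 1%g = id,
      (forall a b, act (a * b)%g = act a \o act b) &
      forall a, S (act a)].

Definition proper_map (X Y : topologicalType) (f : X -> Y) : Prop :=
  continuous f /\ forall K : set Y, compact K -> compact (f @^-1` K).

Definition proper_action (G M : topologicalType) (act : G -> M -> M) : Prop :=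
  proper_map (fun p : G * M => (act p.1 p.2, p.2) : M * M).

(* Main.v *)
Require Import Defs.
From HB Require Import structures.
From mathcomp Require Import all_boot all_order all_algebra.
From mathcomp Require Import all_classical all_reals all_analysis.
From mathcomp Require Import ring lra.
Set Implicit Arguments.
Unset Strict Implicit.
Unset Printing Implicit Defensive.
Import Order.TTheory GRing.Theory Num.Theory.
Import numFieldNormedType.Exports.
Local Open Scope classical_set_scope.
Local Open Scope ring_scope.

(* Write a^* g = F(a, -) g for a in G; then F is a cocycle,
   F(ab, x) = F(a, bx) F(b, x), and v g is G-invariant as soon as
   v(bx) F(b, x) = v(x).  Properness and an exhaustion of M by compact sets give
   a smooth phi >= 0, positive somewhere on each orbit, such that phi(ax)
   vanishes for a outside a compact subset of G, locally uniformly in x.  The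
   average v(x) = I(a |-> phi(ax) F(a, x)), for I a right-invariant positive
   linear functional on C_c(G), solves the equation by the cocycle identity, is
   positive, and is smooth by differentiation under I, since F is jointly smooth
   by its expression through the partial derivatives of the action.
   The functional I is obtained by Weil's construction, as an ultrafilter limit
   of normalised covering numbers, so that no integration theory on G is
   needed. *)

(** * Continuous functions with compact support *)

(** An element of [Conf] comes with a factor smooth in x alone, chosen separately for each a, so
    nothing is known at first about the dependence of F on a. Testing a^*g = F g on one coordinate
    vector writes F as a quotient built from metric coefficients and first derivatives of the
    action, which are jointly smooth by [smooth_map2]. The test needs a nonzero vector: in dimension
    0 the factor is undetermined and may fail to be a cocycle, so that case is separated at the very
    end. Covering numbers are only subadditive. Their defect, relative to a fixed reference
    function, tends to 0 as the covering set shrinks, whence the passage to a limit. Differentiation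
    under I uses linearity and one estimate: on functions supported in a fixed compact set, I is
    bounded by a multiple of the sup norm. This replaces dominated convergence, and it is why the
    group elements contributing to the average must stay in one compact set as x varies locally. *)

Lemma ultra_fmap (T U : Type) (f : T -> U) (F : set_system T) :
  UltraFilter F -> UltraFilter (f x @[x --> F]).
Proof.
move=> UF; split => [|H PH FH]; first exact: fmap_proper_filter.
apply/seteqP; split => [A HA|]; last exact: FH.
have [//|FA] := in_ultra_setVsetC (f @^-1` A) UF.
have HAC : H (~` A) by exact: FH.
have [] := filter_not_empty H.
by rewrite -(setICr A); apply: filterI.
Qed.

(** Replaces the extraction of finite subcovers: local bounds and witnesses are glued along finite
    unions. *)
Lemma compact_ind (X : topologicalType) (K : set X) (P : set X -> Prop) :
  compact K -> P set0 -> (forall A B, A `<=` B -> P B -> P A) ->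
  (forall A B, P A -> P B -> P (A `|` B)) ->
  (forall x, K x -> exists2 U, nbhs x U & P U) -> P K.
Proof.
move=> cK P0 Psub PU PK.
(* The tails of the family of sets satisfying [P], directed by inclusion; stability under unions
   gives closure under intersections. *)
pose F : set_system (set X) :=
  [set S | exists2 B, P B & forall C, P C -> B `<=` C -> S C].
have FF : Filter F.
  split.
  - by exists set0.
  - move=> S T [B PB HB] [C PC HC]; exists (B `|` C); first exact: PU.
    by move=> D PD sD; split; [apply: HB | apply: HC] => // x ?; apply: sD;
      [left | right].
  - by move=> S T ST [B PB HB]; exists B => // C PC BC; exact/ST/HB.
have [|B PB HB] := (compact_near_coveringP K).1 cK _ F (fun B x => B x) FF.
  move=> x /PK [U Ux PUU]; exists (U, [set C | P C /\ U `<=` C]).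
    by split=> //; exists U.
  by move=> [y C] [/= Uy [PC UC]]; exact: UC.
exact: Psub (HB B PB _) PB.
Qed.

Section CompactSupport.
Context {R : realType} {X : topologicalType}.
Implicit Types f g : X -> R.

Definition Cc f :=
  continuous f /\ exists2 K, compact K & forall x, ~ K x -> f x = 0.

Lemma Cc_bounded f : Cc f -> exists2 B : R, 0 <= B & forall x, `|f x| <= B.
Proof.
move=> [cf [K cK fK]].
have : exists2 B : R, 0 <= B & forall x, K x -> `|f x| <= B.
  apply: (compact_ind (P := fun A => exists2 B : R, 0 <= B &
    forall x, A x -> `|f x| <= B)) => //.
  - by exists 0.
  - by move=> A B AB [C C0 HC]; exists C => // x /AB; exact: HC.
  - move=> A B [C C0 HC] [D D0 HD]; exists (C + D); first exact: addr_ge0.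
    move=> x [/HC|/HD] h; apply: (le_trans h).
      by rewrite lerDl.
    by rewrite lerDr.
  move=> x Kx; exists [set y | `|f y| <= `|f x| + 1].
    have /cvgr_norm_le : f y @[y --> x] --> f x by exact: cf.
    by apply; rewrite ltrDl.
  by exists (`|f x| + 1) => //; rewrite addr_ge0.
case=> B B0 HB; exists B => // x.
by case: (pselect (K x)) => [/HB//|/fK ->]; rewrite normr0.
Qed.

Lemma Cc2 (op : R -> R -> R) f g : op 0 0 = 0 ->
  continuous (fun p : R * R => op p.1 p.2) ->
  Cc f -> Cc g -> Cc (fun x => op (f x) (g x)).
Proof.
move=> op0 cop [cf [K cK fK]] [cg [L cL gL]]; split.
  move=> x; apply: (@continuous_comp _ _ _ (fun x => (f x, g x))
    (fun p : R * R => op p.1 p.2)); last exact: cop.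
  exact: (cvg_pair (cf x) (cg x)).
exists (K `|` L); first exact: compactU.
by move=> x /not_orP[/fK -> /gL ->].
Qed.

Lemma CcD f g : Cc f -> Cc g -> Cc (fun x => f x + g x).
Proof.
apply: (@Cc2 (fun x y => x + y)); first by rewrite addr0.
by move=> x; apply: cvgD; [exact: cvg_fst | exact: cvg_snd].
Qed.

Lemma CcB f g : Cc f -> Cc g -> Cc (fun x => f x - g x).
Proof.
apply: (@Cc2 (fun x y => x - y)); first by rewrite subr0.
by move=> x; apply: cvgB; [exact: cvg_fst | exact: cvg_snd].
Qed.

Lemma CcM f g : continuous f -> Cc g -> Cc (fun x => f x * g x).
Proof.
move=> cf [cg [L cL gL]]; split.
  by move=> x; apply: cvgM; [exact: cf | exact: cg].
by exists L => // x /gL ->; rewrite mulr0.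
Qed.

Lemma CcZ c f : Cc f -> Cc (fun x => c * f x).
Proof. by apply: CcM => x; exact: cvg_cst. Qed.

Lemma Cc_max0 f : Cc f -> Cc (fun x => Num.max (f x) 0).
Proof.
move=> [cf [L cL gL]]; split; last by exists L => // x /gL ->; rewrite maxxx.
by move=> x; apply: continuous_max; [exact: cf | exact: cvg_cst].
Qed.

Lemma Cc_sum (I : Type) (r : seq I) (F : I -> X -> R) :
  (forall i, Cc (F i)) -> Cc (fun x => \sum_(i <- r) F i x).
Proof.
move=> CF; elim: r => [|i r IH].
  have -> : (fun x => \sum_(i <- [::]) F i x) = cst 0.
    by apply/funext => x; rewrite big_nil.
  split; first by move=> x; exact: cvg_cst.
  by exists set0 => //; exact: compact0.
have -> : (fun x => \sum_(j <- i :: r) F j x) =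
    (fun x => F i x + \sum_(j <- r) F j x).
  by apply/funext => x; rewrite big_cons.
exact: CcD.
Qed.

End CompactSupport.

(** * The Haar functional *)

Section HaarFunctional.
Context {R : realType} {k : nat} {G : lieGroupType R k}.
Implicit Types (f g : G -> R) (V : set G) (a b : G) (l : seq (R * G)).

Lemma mulg_cvg (T : Type) (F : set_system T) (u v : T -> G) a b : Filter F ->
  u x @[x --> F] --> a -> v x @[x --> F] --> b ->
  (u x * v x)%g @[x --> F] --> (a * b)%g.
Proof.
move=> FF ua vb.
have [cm _] := @mulg_smooth R k G.
apply: (@cvg_comp _ _ _ (fun x => (u x, v x)) (fun p : G * G => (p.1 * p.2)%g)
  _ _ _ (cvg_pair ua vb) (cm (a, b))).
Qed.

Lemma invg_cvg (T : Type) (F : set_system T) (u : T -> G) a : Filter F ->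
  u x @[x --> F] --> a -> (u x)^-1%g @[x --> F] --> a^-1%g.
Proof.
move=> FF ua; have [cm _] := @invg_smooth R k G.
exact: (@cvg_comp _ _ _ u (fun x : G => x^-1%g) _ _ _ ua (cm a)).
Qed.

Lemma mulgr_continuous b : continuous (fun a => a * b)%g.
Proof. by move=> a; apply: mulg_cvg; [exact: cvg_id | exact: cvg_cst]. Qed.

Lemma Cc_translate f b : Cc f -> Cc (fun a => f (a * b)%g).
Proof.
move=> [cf [K cK fK]]; split.
  by move=> a; apply: continuous_comp; [exact: mulgr_continuous | exact: cf].
exists ((fun a => a * b^-1)%g @` K).
  apply: continuous_compact => //; apply: continuous_subspaceT.
  exact: mulgr_continuous.
move=> a nKa; apply: fK => Kab; apply: nKa.
by exists (a * b)%g => //; rewrite -mulgA mulgV mulg1.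
Qed.

(** The condition [V (a * b^-1)] says that [a] lies in the right translate of [V] centred at [b];
    these are the sets used in the coverings below. *)
Lemma Cc_unif_continuous f (d : R) : Cc f -> 0 < d ->
  \forall V \near powerset_filter_from (nbhs (1%g : G)),
    forall a b, V (a * b^-1)%g -> `|f a - f b| <= d.
Proof.
move=> [cf [K cK fK]] d0.
have [W W1 HW] : exists2 W : set G, nbhs 1%g W &
    forall w b, W w -> K b -> `|f (w * b)%g - f b| <= d.
  have := (compact_near_coveringP K).1 cK _ (nbhs (1%g : G))
    (fun w b => `|f (w * b)%g - f b| <= d) (nbhs_filter _).
  move=> H; exists [set w | K `<=` (fun b => `|f (w * b)%g - f b| <= d)];
    last by move=> w b; exact.
  apply: H => x Kx.
  have h : (fun p : G * G => f (p.2 * p.1)%g - f p.1) p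
      @[p --> (x, 1%g : G)] --> f (1 * x)%g - f x.
    apply: cvgB; last by apply: continuous_cvg; [exact: cf | exact: cvg_fst].
    apply: continuous_cvg; first exact: cf.
    by apply: mulg_cvg; [exact: cvg_snd | exact: cvg_fst].
  have /cvgr_norm_le /(_ d) := h; apply.
  by rewrite mul1g subrr normr0.
(* Symmetrising [W] handles [a] in [K] with [b] outside; when both lie outside, both values are
   0. *)
have W'1 : nbhs (1%g : G) (W `&` [set w | W w^-1%g]).
  apply: filterI => //.
  have : (fun a : G => a^-1%g) x @[x --> (1%g : G)] --> (1^-1)%g.
    by apply: invg_cvg; exact: cvg_id.
  by rewrite invg1; apply.
near=> V.
move=> a b Vab.
have [Wab Wba] : (W `&` [set w | W w^-1%g]) (a * b^-1)%g.
  move: Vab; apply: (_ : V `<=` _).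
  by near: V; exact: small_set_sub.
case: (pselect (K b)) => [Kb|nKb].
  by have := HW _ _ Wab Kb; rewrite -mulgA mulVg mulg1.
case: (pselect (K a)) => [Ka|nKa].
  have := HW _ _ Wba Ka; rewrite /= invgM invgK -mulgA mulVg mulg1.
  by rewrite distrC.
by rewrite (fK _ nKa) (fK _ nKb) subrr normr0 ltW.
Unshelve. all: by end_near. Qed.

(** * Weighted coverings by right translates *)

Definition coverage l g a : R := \sum_(p <- l) p.1 * g (a * p.2)%g.
Definition cost l : R := \sum_(p <- l) p.1.
Definition nonneg_weights l := forall p, p \in l -> 0 <= p.1.

(** The admissible totals whose infimum is Weil's covering number (f : g). Keeping the totals avoids
    any question of attainment, and each rule below becomes an operation on lists. *)
Definition dominated g f (s : R) :=
  exists l, [/\ nonneg_weights l, cost l = s & forall a, f a <= coverage l g a].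

(** Covering each translate of [g] by translates of [h] multiplies weights and composes
    translations. *)
Lemma dominated_trans h g f s t :
  dominated h g t -> dominated g f s -> dominated h f (s * t).
Proof.
move=> [m [m0 <- gm]] [l [l0 <- fl]].
exists [seq (p.1 * q.1, (p.2 * q.2)%g) | p <- l, q <- m]; split.
- by move=> p /allpairsP[[q r] /= [/l0 q0 /m0 r0 ->]]; exact: mulr_ge0.
- rewrite /cost big_allpairs_dep mulr_suml; apply: eq_bigr => p _.
  by rewrite mulr_sumr.
move=> a; apply: (le_trans (fl a)).
rewrite /coverage big_allpairs_dep !big_seq; apply: ler_sum => p pl.
under eq_bigr do rewrite -mulrA.
rewrite -mulr_sumr; apply: ler_wpM2l; first exact: l0.
by under eq_bigr do rewrite mulgA; exact: gm.
Qed.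

Lemma dominated_translate g f s b :
  dominated g f s -> dominated g (fun a => f (a * b)%g) s.
Proof.
move=> [l [l0 <- fl]]; exists [seq (p.1, (b * p.2)%g) | p <- l]; split.
- by move=> p /mapP[q /l0 q0 ->].
- by rewrite /cost big_map.
move=> a; apply: (le_trans (fl _)); rewrite /coverage big_map /=.
by under eq_bigr do rewrite -mulgA.
Qed.

Lemma dominatedD g f1 f2 s1 s2 : dominated g f1 s1 -> dominated g f2 s2 ->
  dominated g (fun a => f1 a + f2 a) (s1 + s2).
Proof.
move=> [l [l0 <- fl]] [m [m0 <- fm]]; exists (l ++ m); split.
- by move=> p; rewrite mem_cat => /orP[/l0|/m0].
- by rewrite /cost big_cat.
by move=> a; rewrite /coverage big_cat; exact: lerD.
Qed.

Lemma dominatedZ g f (c : R) s : 0 <= c -> dominated g f s ->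
  dominated g (fun a => c * f a) (c * s).
Proof.
move=> c0 [l [l0 <- fl]]; exists [seq (c * p.1, p.2) | p <- l]; split.
- by move=> p /mapP[q /l0 q0 ->]; exact: mulr_ge0.
- by rewrite /cost big_map mulr_sumr.
move=> a; rewrite /coverage big_map /=.
by under eq_bigr do rewrite -mulrA; rewrite -mulr_sumr ler_wpM2l.
Qed.

Lemma dominated_le g f1 f2 s : (forall a, f1 a <= f2 a) -> dominated g f2 s ->
  dominated g f1 s.
Proof.
by move=> f12 [l [l0 sl fl]]; exists l; split => // a; exact: le_trans (fl a).
Qed.

Lemma dominated_ge0 g f s : dominated g f s -> 0 <= s.
Proof. by move=> [l [l0 <- _]]; rewrite /cost big_seq; exact: sumr_ge0. Qed.

(** Evaluation at one point bounds the cost of a covering from below, which keeps covering numbers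
    of nonzero functions away from 0. *)
Lemma dominated_value g f s (B : R) a : (forall a, g a <= B) ->
  dominated g f s -> f a <= s * B.
Proof.
move=> gB [l [l0 <- fl]]; apply: (le_trans (fl a)).
rewrite /coverage /cost mulr_suml !big_seq; apply: ler_sum => p pl.
by apply: ler_wpM2l; [exact: l0 | exact: gB].
Qed.

Lemma coverage_ge0 l g a : nonneg_weights l -> (forall b, 0 <= g b) ->
  0 <= coverage l g a.
Proof.
move=> l0 g0; rewrite /coverage big_seq; apply: sumr_ge0 => p /l0 p0.
exact: mulr_ge0.
Qed.

(** A lower bound near one point is asked of [g] instead of continuity, so that the indicator of a
    neighbourhood of 1 qualifies. Coverings are glued by concatenating lists. *)
Lemma coverage_compact_near g b (c : R) K : (forall a, 0 <= g a) -> 0 < c ->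
  (\forall a \near b, c <= g a) -> compact K ->
  exists2 l, nonneg_weights l & forall a, K a -> 1 <= coverage l g a.
Proof.
move=> g0 c0 gc cK.
apply: (compact_ind (P := fun A => exists2 l, nonneg_weights l &
  forall a, A a -> 1 <= coverage l g a)) => //.
- by exists [::].
- by move=> A A' AA' [l l0 lA']; exists l => // a /AA'; exact: lA'.
- move=> A A' [l l0 lA] [m m0 mA']; exists (l ++ m).
    by move=> p; rewrite mem_cat => /orP[/l0|/m0].
  move=> a; rewrite /coverage big_cat /= => -[/lA|/mA'] h; apply: (le_trans h).
    by rewrite lerDl; exact: coverage_ge0.
  by rewrite lerDr; exact: coverage_ge0.
(* Right translation by [x^-1 * b] carries [x] to [b], and the weight [c^-1] lifts the bound [c] to
   1. *)
move=> x Kx; exists [set a | c <= g (a * (x^-1 * b))%g].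
  have : (a * (x^-1 * b))%g @[a --> x] --> (x * (x^-1 * b))%g.
    exact: mulgr_continuous.
  by rewrite mulgA mulgV mul1g => h; exact: (h _ gc).
exists [:: (c^-1, (x^-1 * b)%g)].
  by move=> p; rewrite inE => /eqP ->; rewrite invr_ge0 ltW.
by move=> a /= ca; rewrite /coverage big_seq1 /= ler_pdivlMl // mulr1.
Qed.

Lemma dominated_exists g f b (c : R) : (forall a, 0 <= g a) -> 0 < c ->
  (\forall a \near b, c <= g a) -> Cc f -> exists s, dominated g f s.
Proof.
move=> g0 c0 gc Cf; have [B B0 fB] := Cc_bounded Cf.
have [_ [K cK fK]] := Cf; have [l l0 lK] := coverage_compact_near g0 c0 gc cK.
exists (B * cost l).
apply: (@dominated_le _ _ (fun a => B * coverage l g a)); last first.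
  by apply: dominatedZ => //; exists l; split.
move=> a; case: (pselect (K a)) => [/lK|/fK ->].
  by move=> h; apply: (le_trans (ler_norm _)); apply: (le_trans (fB a));
    rewrite ler_peMr.
by rewrite mulr_ge0 // coverage_ge0.
Qed.

Lemma continuous_near_half g b : continuous g -> 0 < g b ->
  0 < g b / 2 /\ \forall a \near b, g b / 2 <= g a.
Proof.
move=> cg gb; split; first by rewrite divr_gt0.
have /cvgr_ge : g a @[a --> b] --> g b by exact: cg.
by apply; rewrite ltr_pdivrMr // ltr_pMr // ltr1n.
Qed.

Lemma coverage_compact g b K : continuous g -> (forall a, 0 <= g a) ->
  0 < g b -> compact K ->
  exists2 l, nonneg_weights l & forall a, K a -> 1 <= coverage l g a.
Proof.
move=> cg g0 gb; have [c0 gc] := continuous_near_half cg gb.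
exact: coverage_compact_near gc.
Qed.

Lemma dominated_exists_continuous g f b : continuous g -> (forall a, 0 <= g a) ->
  0 < g b -> Cc f -> exists s, dominated g f s.
Proof.
move=> cg g0 gb; have [c0 gc] := continuous_near_half cg gb.
exact: dominated_exists gc.
Qed.

Lemma Cc_coverage l g : Cc g -> Cc (coverage l g).
Proof. by move=> Cg; apply: Cc_sum => p; exact/CcZ/Cc_translate. Qed.

(* Weil's covering number (f : 1_V), for right translates of 1_V. *)
Definition cover_number f V : R := inf (dominated \1_V f).

Lemma indic_bounds V a : 0 <= (\1_V a : R) <= 1.
Proof. by rewrite indicE; case: (_ \in _); rewrite ?lexx ?ler01. Qed.

Lemma indic_near V : nbhs (1%g : G) V -> \forall a \near (1%g : G), 1 <= (\1_V a : R).
Proof. by apply: filterS => a Va; rewrite indicE mem_set. Qed.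

Lemma dominated_indic f V : nbhs (1%g : G) V -> Cc f ->
  exists s, dominated \1_V f s.
Proof.
move=> V1; apply: (@dominated_exists _ _ 1%g 1) => //.
exact: indic_near.
Qed.

Lemma cover_number_le f V s : dominated \1_V f s -> cover_number f V <= s.
Proof. by move=> fs; apply: ge_inf => //; exists 0 => t /dominated_ge0. Qed.

Lemma cover_number_ge f V x (t : R) : nbhs (1%g : G) V -> Cc f -> 0 <= t ->
  (forall s, dominated \1_V f s -> x <= t * s) -> x <= t * cover_number f V.
Proof.
move=> V1 Cf; have [s0 fs0] := dominated_indic V1 Cf.
(* At [t = 0] division is impossible; the single total [s0] turns the hypothesis into [x <= 0]. *)
rewrite le_eqVlt => /predU1P[<- H|t0 H].
  by rewrite mul0r; have := H _ fs0; rewrite mul0r.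
rewrite mulrC -ler_pdivrMr //; apply: lb_le_inf; first by exists s0.
by move=> s /H; rewrite mulrC -ler_pdivrMr.
Qed.

Lemma cover_number_ge0 f V : nbhs (1%g : G) V -> Cc f -> 0 <= cover_number f V.
Proof.
move=> V1 Cf; rewrite -[leRHS]mul1r; apply: cover_number_ge => // s.
by move=> /dominated_ge0; rewrite mul1r.
Qed.

Lemma cover_number_submul f g V t : nbhs (1%g : G) V -> Cc g ->
  dominated g f t -> cover_number f V <= t * cover_number g V.
Proof.
move=> V1 Cg fg; apply: cover_number_ge => // [|s gs].
  exact: dominated_ge0 fg.
exact/cover_number_le/dominated_trans/fg.
Qed.

Lemma cover_number_translate_le f V b : nbhs (1%g : G) V -> Cc f ->
  cover_number (fun a => f (a * b)%g) V <= cover_number f V.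
Proof.
move=> V1 Cf; rewrite -[leRHS]mul1r; apply: cover_number_ge => // s fs.
by rewrite mul1r; exact/cover_number_le/dominated_translate.
Qed.

Lemma cover_number_translate f V b : nbhs (1%g : G) V -> Cc f ->
  cover_number (fun a => f (a * b)%g) V = cover_number f V.
Proof.
move=> V1 Cf; apply/eqP; rewrite eq_le cover_number_translate_le //=.
(* The reverse inequality is the first one applied to the translate, moved back by [b^-1]. *)
have := cover_number_translate_le b^-1%g V1 (Cc_translate b Cf).
by under [X in cover_number X _]eq_fun do rewrite -mulgA mulVg mulg1.
Qed.

Lemma cover_number_subadd f1 f2 V : nbhs (1%g : G) V -> Cc f1 -> Cc f2 ->
  cover_number (fun a => f1 a + f2 a) V <=
    cover_number f1 V + cover_number f2 V.
Proof.
move=> V1 C1 C2; rewrite -lerBlDr -[leRHS]mul1r.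
apply: cover_number_ge => // s1 fs1.
rewrite mul1r lerBlDr -lerBlDl -[leRHS]mul1r.
apply: cover_number_ge => // s2 fs2; rewrite mul1r lerBlDl.
exact/cover_number_le/dominatedD.
Qed.

Lemma cover_numberZ_le f V (c : R) : nbhs (1%g : G) V -> Cc f -> 0 <= c ->
  cover_number (fun a => c * f a) V <= c * cover_number f V.
Proof.
move=> V1 Cf c0; apply: cover_number_ge => // s fs.
exact/cover_number_le/dominatedZ.
Qed.

Lemma cover_numberZ f V (c : R) : nbhs (1%g : G) V -> Cc f -> 0 < c ->
  cover_number (fun a => c * f a) V = c * cover_number f V.
Proof.
move=> V1 Cf c0; apply/eqP; rewrite eq_le cover_numberZ_le ?(ltW c0) //=.
have c'0 : 0 <= c^-1 by rewrite invr_ge0 ltW.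
have := cover_numberZ_le V1 (CcZ c Cf) c'0.
under [X in cover_number X _]eq_fun do rewrite mulKf ?gt_eqF//.
by rewrite ler_pdivlMl.
Qed.

(** [F] may vanish outside [K]. Near such a point [F < d], which excludes [K], so the quotient is
    locally the zero function. *)
Lemma quotient_Cc f F K (d : R) : continuous f -> continuous F -> compact K ->
  (forall a, ~ K a -> f a = 0) -> 0 < d -> (forall a, K a -> d <= F a) ->
  Cc (fun a => f a / F a).
Proof.
move=> cf cF cK fK d0 FK; split; last first.
  by exists K => // a /fK ->; rewrite mul0r.
move=> a; case: (eqVneq (F a) 0) => [Fa0|Fa0]; last first.
  by apply: cvgM; [exact: cf | apply: cvgV => //; exact: cF].
have near0 : \forall b \near a, f b = 0.
  have /cvgr_lt /(_ d) : F b @[b --> a] --> F a by exact: cF.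
  rewrite Fa0 => /(_ d0); apply: filterS => b Fb.
  by apply: fK => /FK; rewrite leNgt Fb.
rewrite /continuous_at (nbhs_singleton near0) mul0r.
apply: cvg_near_cst; apply: filterS near0 => b ->; by rewrite mul0r.
Qed.

Section Normalized.
Variables (f0 : G -> R) (b0 : G).
Hypotheses (Cf0 : Cc f0) (f0_ge0 : forall a, 0 <= f0 a) (f0b0 : 0 < f0 b0).

(* The quotients f_i / (f1 + f2 + d f'), with f' >= 1 on the supports, are
   uniformly continuous, hence nearly constant on each translate of a small V:
   multiplying the weights of a covering of the denominator by their values
   gives coverings of f1 and f2. *)
Lemma cover_number_superadd f1 f2 (e : R) : Cc f1 -> (forall a, 0 <= f1 a) ->
  Cc f2 -> (forall a, 0 <= f2 a) -> 0 < e ->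
  \forall V \near powerset_filter_from (nbhs (1%g : G)),
    cover_number f1 V + cover_number f2 V <=
      cover_number (fun a => f1 a + f2 a) V + e * cover_number f0 V.
Proof.
move=> C1 f1_ge0 C2 f2_ge0 e0.
have [cf1 [K1 cK1 fK1]] := C1; have [cf2 [K2 cK2 fK2]] := C2.
have [l l0 lK] := coverage_compact Cf0.1 f0_ge0 f0b0 (compactU cK1 cK2).
set f' := coverage l f0 in lK.
have Cf' : Cc f' by exact: Cc_coverage.
have f'_ge0 a : 0 <= f' a by exact: coverage_ge0.
have [t ft] := dominated_exists_continuous Cf0.1 f0_ge0 f0b0 (CcD C1 C2).
have [t' ft'] := dominated_exists_continuous Cf0.1 f0_ge0 f0b0 Cf'.
have t0 := dominated_ge0 ft; have t'0 := dominated_ge0 ft'.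
(* Chosen for the final estimate: expanding (1 + 2d)(y + d w) with d <= 1, y <= t z and w <= t' z
   leaves an error of at most d (2t + 3t') z <= e z. In the application z is (f0 : V). *)
pose d : R := Num.min 1 (e / (2 * t + 3 * t' + 1)).
have T0 : 0 < 2 * t + 3 * t' + 1 by lra.
have d0 : 0 < d by rewrite lt_min ltr01 divr_gt0.
have d1 : d <= 1 by rewrite ge_min lexx.
have de : d * (2 * t + 3 * t') <= e.
  have : d <= e / (2 * t + 3 * t' + 1) by rewrite ge_min lexx orbT.
  rewrite ler_pdivlMr // => h; apply: le_trans h; rewrite ler_wpM2l ?ltW//.
  by rewrite ltrDl.
have arith c w x y z : c <= (1 + 2 * d) * x -> x <= y + d * w -> y <= t * z ->
    w <= t' * z -> 0 <= z -> 0 <= w -> c <= y + e * z.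
  move=> key h1 h2 h3 h4 w0; apply: (le_trans key).
  have k1 : (1 + 2 * d) * x <= (1 + 2 * d) * (y + d * w).
    by rewrite ler_wpM2l //; lra.
  apply: (le_trans k1).
  have k2 : (1 + 2 * d) * (d * w) <= 3 * (d * (t' * z)).
    apply: ler_pM; [lra| |lra|]; last by rewrite ler_wpM2l // ltW.
    by rewrite mulr_ge0 ?(ltW d0).
  have k3 : 2 * d * y <= 2 * d * (t * z) by rewrite ler_wpM2l //; lra.
  have k4 : d * (2 * t + 3 * t') * z <= e * z by rewrite ler_wpM2r.
  rewrite mulrDr mulrDl mul1r.
  apply: (@le_trans _ _ (y + 2 * d * (t * z) + 3 * (d * (t' * z)))).
    by rewrite lerD // lerD2l.
  rewrite -addrA lerD2l; apply: le_trans k4.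
  by rewrite le_eqVlt; apply/orP; left; apply/eqP; ring.
(* The term [d * f' a] keeps the denominator at least [d] on both supports. *)
pose F a := f1 a + f2 a + d * f' a.
have CF : Cc F by apply: CcD; [exact: CcD | exact: CcZ].
have FK a : (K1 `|` K2) a -> d <= F a.
  move=> /lK h; have := f1_ge0 a; have := f2_ge0 a.
  have : d * 1 <= d * f' a by rewrite ler_wpM2l // ltW.
  by rewrite /F; lra.
have F0 a : 0 <= F a.
  by rewrite !addr_ge0// mulr_ge0// ltW.
have Ch1 : Cc (fun a => f1 a / F a).
  apply: (quotient_Cc cf1 CF.1 cK1 fK1 d0) => a K1a; apply: FK; by left.
have Ch2 : Cc (fun a => f2 a / F a).
  apply: (quotient_Cc cf2 CF.1 cK2 fK2 d0) => a K2a; apply: FK; by right.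
have FE f a : (forall a, F a = 0 -> f a = 0) ->
    f a = F a * (f a / F a).
  move=> H; case: (eqVneq (F a) 0) => [Fa|Fa]; first by rewrite H // Fa mul0r.
  by rewrite mulrC divfK.
have sum0 a : F a = 0 -> f1 a = 0 /\ f2 a = 0.
  have := f1_ge0 a; have := f2_ge0 a.
  have : 0 <= d * f' a by rewrite mulr_ge0 // ltW.
  by rewrite /F; split; lra.
(* A translate [1_V (a * s)] is nonzero only for [a] near [s^-1], where the quotient exceeds its
   value at [s^-1] by at most [d]. *)
have piece f (V : set G) m : (forall a, 0 <= f a) ->
    (forall a, F a = 0 -> f a = 0) ->
    (forall a b, V (a * b^-1)%g -> `|f a / F a - f b / F b| <= d) ->
    nonneg_weights m -> (forall a, F a <= coverage m \1_V a) ->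
    cover_number f V <= \sum_(p <- m) p.1 * (f p.2^-1%g / F p.2^-1%g + d).
  move=> f_ge0 fF0 fd m0 Fm; apply: cover_number_le.
  exists [seq (p.1 * (f p.2^-1%g / F p.2^-1%g + d), p.2) | p <- m]; split.
  - move=> p /mapP[q /m0 q0 ->]; apply: mulr_ge0 => //.
    by rewrite addr_ge0 ?divr_ge0 ?(ltW d0).
  - by rewrite /cost big_map.
  move=> a; rewrite [leLHS](FE f) //.
  apply: (@le_trans _ _ (coverage m \1_V a * (f a / F a))).
    by rewrite ler_wpM2r // divr_ge0.
  rewrite /coverage big_map /= mulr_suml !big_seq; apply: ler_sum => p pm.
  rewrite -!mulrA; apply: ler_wpM2l; first exact: m0.
  rewrite indicE; case: (boolP (_ \in V)) => [/set_mem Va|_]; last first.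
    by rewrite mul0r mulr0.
  rewrite mul1r mulr1 -lerBlDl; apply: (le_trans (ler_norm _)); apply: fd.
  by rewrite invgK.
near=> V.
have V1 : nbhs (1%g : G) V by near: V; exact: near_small_set.
have key : cover_number f1 V + cover_number f2 V <=
    (1 + 2 * d) * cover_number F V.
  apply: cover_number_ge => // [|s [m [m0 <- Fm]]]; first lra.
  have h1 : forall a b, V (a * b^-1)%g -> `|f1 a / F a - f1 b / F b| <= d.
    by near: V; exact: (Cc_unif_continuous Ch1 d0).
  have h2 : forall a b, V (a * b^-1)%g -> `|f2 a / F a - f2 b / F b| <= d.
    by near: V; exact: (Cc_unif_continuous Ch2 d0).
  have := piece f1 V m f1_ge0 (fun a h => (sum0 a h).1) h1 m0 Fm.
  have := piece f2 V m f2_ge0 (fun a h => (sum0 a h).2) h2 m0 Fm.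
  move=> p2 p1; apply: (le_trans (lerD p1 p2)).
  rewrite -big_split /= /cost mulr_sumr !big_seq; apply: ler_sum => p pm.
  rewrite -mulrDr [leRHS]mulrC; apply: ler_wpM2l; first exact: m0.
  set b := (p.2^-1)%g.
  (* At each centre the two quotients add up to at most 1, and the two margins to [2 * d]. *)
  suff : f1 b / F b + f2 b / F b <= 1 by lra.
  rewrite -mulrDl; case: (eqVneq (F b) 0) => [->|Fb].
    by rewrite invr0 mulr0.
  rewrite ler_pdivrMr ?lt_neqAle 1?eq_sym ?Fb ?F0 // mul1r /F lerDl.
  by rewrite mulr_ge0 // ltW.
have h1 : cover_number F V <=
    cover_number (fun a => f1 a + f2 a) V + d * cover_number f' V.
  apply: (le_trans (cover_number_subadd V1 (CcD C1 C2) (CcZ d Cf'))).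
  by rewrite lerD2l cover_numberZ.
have h2 := cover_number_submul V1 Cf0 ft.
have h3 := cover_number_submul V1 Cf0 ft'.
have h4 := cover_number_ge0 V1 Cf0.
exact: (arith _ _ _ _ _ key h1 h2 h3 h4 (cover_number_ge0 V1 Cf')).
Unshelve. all: by end_near. Qed.

Lemma cover_number_f0_gt0 V : nbhs (1%g : G) V -> 0 < cover_number f0 V.
Proof.
move=> V1; apply: (lt_le_trans f0b0); rewrite -[leRHS]mul1r.
apply: cover_number_ge => // s f0s; rewrite mul1r -[leRHS]mulr1.
by apply: dominated_value f0s => a; have /andP[] := indic_bounds V a.
Qed.

(** The ratio (f : V) / (f0 : V) stays in a compact interval [0, t], so it converges along an
    ultrafilter of shrinking [V], one ultrafilter serving all [f]. Exact rules pass to the limit,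
    and additivity appears there because the defect is eventually below every e. *)
Lemma positive_haar_functional : exists J : (G -> R) -> R,
  [/\ forall f g, Cc f -> (forall a, 0 <= f a) -> Cc g -> (forall a, 0 <= g a) ->
        J (fun a => f a + g a) = J f + J g,
      forall (c : R) f, 0 < c -> Cc f -> (forall a, 0 <= f a) ->
        J (fun a => c * f a) = c * J f,
      forall f b, Cc f -> (forall a, 0 <= f a) -> J (fun a => f (a * b)%g) = J f &
      forall f a, Cc f -> (forall a, 0 <= f a) -> 0 < f a -> 0 < J f].
Proof.
pose W := powerset_filter_from (nbhs (1%g : G)).
have PW : ProperFilter W by exact: powerset_filter_from_filter.
have [U [UU WU]] := ultraFilterLemma PW.
have PU : ProperFilter U by exact: ultra_proper.
have U1 : \forall V \near U, nbhs (1%g : G) V by apply: WU; exact: near_small_set.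
pose ratio f V := cover_number f V / cover_number f0 V.
have ratio_le f t : dominated f0 f t -> \forall V \near U, ratio f V <= t.
  move=> ft; apply: filterS U1 => V V1.
  by rewrite ler_pdivrMr ?cover_number_f0_gt0 //; exact: cover_number_submul.
have ratio_ge0 f : Cc f -> \forall V \near U, 0 <= ratio f V.
  by move=> Cf; apply: filterS U1 => V V1; rewrite divr_ge0 ?cover_number_ge0.
have ratio_cvg f : Cc f -> ratio f V @[V --> U] --> lim (ratio f V @[V --> U]).
  move=> Cf; apply/cvg_ex.
  have [t ft] := dominated_exists_continuous Cf0.1 f0_ge0 f0b0 Cf.
  have : compact (`[0, t]%classic : set R) by exact: segment_compact.
  rewrite compact_ultra => /(_ (ratio f V @[V --> U]) (ultra_fmap _ UU)).
  case; last by move=> l [_ cl]; exists l.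
  apply: filterS2 (ratio_le _ _ ft) (ratio_ge0 _ Cf) => V h1 h2.
  by rewrite /= in_itv /= h1 h2.
exists (fun f => lim (ratio f V @[V --> U])); split.
- move=> f g Cf f_ge0 Cg g_ge0.
  have cs : ratio f V + ratio g V - ratio (fun a => f a + g a) V @[V --> U] -->
      lim (ratio f V @[V --> U]) + lim (ratio g V @[V --> U]) -
      lim (ratio (fun a => f a + g a) V @[V --> U]).
    by apply: cvgB; [apply: cvgD|]; apply: ratio_cvg => //; exact: CcD.
  apply/eqP; rewrite eq_sym -subr_eq0; apply/eqP.
  apply/(cvg_unique (@Rhausdorff R) cs)/cvgrPdist_le => e e0.
  have := WU _ (cover_number_superadd Cf f_ge0 Cg g_ge0 e0).
  apply: filterS2 U1 => V V1 h; rewrite sub0r normrN.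
  have V0 := cover_number_f0_gt0 V1.
  rewrite /ratio -mulrDl -mulrBl ger0_norm; last first.
    by rewrite divr_ge0 ?(ltW V0) // subr_ge0 cover_number_subadd.
  by rewrite ler_pdivrMr // lerBlDl.
- move=> c f c0 Cf f_ge0.
  apply/(cvg_unique (@Rhausdorff R) (ratio_cvg _ (CcZ c Cf))).
  have cs : c * ratio f V @[V --> U] --> c * lim (ratio f V @[V --> U]).
    by apply: cvgMr; exact: ratio_cvg.
  apply: cvg_trans cs; apply: near_eq_cvg; apply: filterS U1 => V V1.
  by rewrite /ratio cover_numberZ // mulrA.
- move=> f b Cf f_ge0.
  apply/(cvg_unique (@Rhausdorff R) (ratio_cvg _ (Cc_translate b Cf))).
  apply: cvg_trans (ratio_cvg _ Cf); apply: near_eq_cvg.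
  by apply: filterS U1 => V V1; rewrite /ratio cover_number_translate.
(* A covering of [f0] by translates of [f] of cost [t] gives (f0 : V) <= t (f : V), hence the lower
   bound [t^-1] for the ratios. *)
- move=> f a Cf f_ge0 fa.
  have [t f0t] := dominated_exists_continuous Cf.1 f_ge0 fa Cf0.
  have t0 : 0 < t.
    rewrite lt_neqAle (dominated_ge0 f0t) andbT; apply/eqP => t0.
    have [B _ fB] := Cc_bounded Cf.
    have := @dominated_value f f0 t B b0 (fun a => le_trans (ler_norm _) (fB a)) f0t.
    by rewrite -t0 mul0r leNgt f0b0.
  apply: (@lt_le_trans _ _ t^-1); first by rewrite invr_gt0.
  apply: (cvgr_to_ge (ratio_cvg _ Cf)); apply: filterS U1 => V V1.
  rewrite ler_pdivlMr ?cover_number_f0_gt0 // mulrC ler_pdivrMr // mulrC.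
  exact: cover_number_submul.
Qed.

End Normalized.

(** Extends the functional to signed functions by positive and negative parts. Differences in the
    first clause and the sup bound in the last are what estimates of difference quotients call
    for. *)
Theorem haar_functional : exists I : (G -> R) -> R,
  [/\ forall f g, Cc f -> Cc g -> I (fun a => f a - g a) = I f - I g,
      forall (c : R) f, Cc f -> I (fun a => c * f a) = c * I f,
      forall f a, Cc f -> (forall b, 0 <= f b) -> 0 < f a -> 0 < I f,
      forall f b, Cc f -> I (fun a => f (a * b)%g) = I f &
      forall K, compact K -> exists C, forall f (e : R), Cc f ->
        (forall a, ~ K a -> f a = 0) -> (forall a, `|f a| <= e) ->
        `|I f| <= e * C].
Proof.
have [[f0 [b0 [Cf0 f0_ge0 f0b0]]]|no_f0] := pselect (exists f0 b0,
    [/\ Cc f0, forall a, 0 <= f0 a & 0 < f0 b0]); last first.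
  (* No nonzero function has compact support: the zero functional will do. *)
  exists (fun=> 0); split.
  - by move=> *; rewrite subr0.
  - by move=> *; rewrite mulr0.
  - by move=> f a Cf f_ge0 fa; case: no_f0; exists f, a.
  - by [].
  - by move=> K cK; exists 0 => *; rewrite normr0 mulr0.
have [J [JD JZ Jtr Jpos]] := positive_haar_functional Cf0 f0_ge0 f0b0.
have C0 : Cc (fun _ : G => 0 : R).
  by have := CcB Cf0 Cf0; under eq_fun do rewrite subrr.
have J0 : J (fun=> 0) = 0.
  have := JD _ _ C0 (fun=> lexx _) C0 (fun=> lexx _).
  under [X in J X = _ -> _]eq_fun do rewrite addr0.
  by move=> /eqP; rewrite -subr_eq0 opprD addrA subrr sub0r oppr_eq0 => /eqP.
pose pos (f : G -> R) a := Num.max (f a) 0.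
pose I f := J (pos f) - J (pos (fun a => - f a)).
have CN f : Cc f -> Cc (fun a => - f a).
  by move=> Cf; have := CcB C0 Cf; under eq_fun do rewrite sub0r.
have Cpos f : Cc f -> Cc (pos f) by exact: Cc_max0.
have pos_ge0 f a : 0 <= pos f a by rewrite /pos le_max lexx orbT.
have posE f a : f a = pos f a - pos (fun b => - f b) a.
  rewrite /pos; have [h|h] := leP 0 (f a).
    by rewrite max_r ?oppr_le0 // subr0.
  by rewrite max_l ?oppr_ge0 ?ltW // sub0r opprK.
have IE f1 f2 : Cc f1 -> (forall a, 0 <= f1 a) -> Cc f2 ->
    (forall a, 0 <= f2 a) -> I (fun a => f1 a - f2 a) = J f1 - J f2.
  move=> Cf1 f1_ge0 Cf2 f2_ge0; set f := fun a => f1 a - f2 a.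
  have Cf : Cc f by exact: CcB.
  (* Rearranging both decompositions of [f] so that only sums of nonnegative functions occur reduces
     independence of the decomposition to additivity of [J]. *)
  have : J (fun a => pos f a + f2 a) = J (fun a => pos (fun b => - f b) a + f1 a).
    by congr J; apply/funext => a; have := posE f a; rewrite {1}/f; lra.
  by rewrite !JD //; [rewrite /I; lra | exact/Cpos/CN | exact: Cpos].
have I_ge0 f : Cc f -> (forall a, 0 <= f a) -> 0 <= I f /\ I f = J f.
  move=> Cf f_ge0; have IJ : I f = J f.
    have := IE f (fun=> 0) Cf f_ge0 C0 (fun=> lexx _).
    by under eq_fun do rewrite subr0; rewrite J0 subr0.
  split=> //; rewrite IJ; case: (pselect (exists a, 0 < f a)) => [[a fa]|nf].
    by apply/ltW/(Jpos f a).
  suff -> : f = fun=> 0 by rewrite J0.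
  apply/funext => a; apply/eqP; rewrite eq_le f_ge0 andbT leNgt.
  by apply/negP => fa; apply: nf; exists a.
have IZpos (c : R) f : 0 <= c -> Cc f -> I (fun a => c * f a) = c * I f.
  rewrite le_eqVlt => /predU1P[<- Cf|c0 Cf].
    rewrite mul0r; under eq_fun do rewrite mul0r.
    by rewrite (I_ge0 _ C0 _).2.
  have -> : (fun a => c * f a) =
      (fun a => c * pos f a - c * pos (fun b => - f b) a).
    by apply/funext => a; rewrite {1}(posE f a) mulrBr.
  have [Cp Cn] : Cc (pos f) /\ Cc (pos (fun b => - f b)).
    by split; [exact: Cpos | exact/Cpos/CN].
  rewrite IE; [|exact: CcZ|by move=> a; rewrite mulr_ge0 // ltW
    |exact: CcZ|by move=> a; rewrite mulr_ge0 // ltW].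
  by rewrite !JZ // -mulrBr.
have IB f g : Cc f -> Cc g -> I (fun a => f a - g a) = I f - I g.
  move=> Cf Cg.
  have [Cp Cn] : Cc (pos f) /\ Cc (pos (fun b => - f b)).
    by split; [exact: Cpos | exact/Cpos/CN].
  have [Dp Dn] : Cc (pos g) /\ Cc (pos (fun b => - g b)).
    by split; [exact: Cpos | exact/Cpos/CN].
  have -> : (fun a => f a - g a) = (fun a =>
      (pos f a + pos (fun b => - g b) a) - (pos (fun b => - f b) a + pos g a)).
    by apply/funext => a; rewrite {1}(posE f a) {1}(posE g a); ring.
  rewrite IE; [|exact: CcD|by move=> a; rewrite addr_ge0
    |exact: CcD|by move=> a; rewrite addr_ge0].
  by rewrite !JD // /I; ring.
have IN f : Cc f -> I (fun a => - f a) = - I f.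
  move=> Cf; have := IB _ _ C0 Cf; under eq_fun do rewrite sub0r.
  by rewrite (I_ge0 _ C0 _).2 // J0 sub0r.
have I0 : I (fun=> 0) = 0 by rewrite (I_ge0 _ C0 _).2.
exists I; split => //.
- move=> c f Cf; have [/IZpos|c0] := leP 0 c; first exact.
  have := IZpos (- c) _ _ Cf; rewrite oppr_ge0 => /(_ (ltW c0)).
  under eq_fun do rewrite mulNr.
  by rewrite (IN _ (CcZ c Cf)) mulNr => /oppr_inj.
- by move=> f a Cf f_ge0 fa; rewrite (I_ge0 f Cf f_ge0).2; exact: Jpos fa.
- by move=> f b Cf; rewrite /I; congr (_ - _);
    rewrite -[RHS](Jtr _ b) //; apply: Cpos => //;
    exact: CN.
(* A combination of translates of [f0] that is at least 1 on [K] majorises every [f] supported in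
   [K] with [|f| <= 1]; its value is the constant. *)
move=> K cK.
have [l l0 lK] := coverage_compact Cf0.1 f0_ge0 f0b0 cK.
have Cchi : Cc (coverage l f0) by exact: Cc_coverage.
exists (I (coverage l f0)) => f e Cf fK fe.
have e0 : 0 <= e by apply: le_trans (fe 1%g).
have f_le a : `|f a| <= e * coverage l f0 a.
  have [/lK h|/fK ->] := pselect (K a).
    by apply: (le_trans (fe a)); rewrite ler_peMr.
  by rewrite normr0 mulr_ge0 // coverage_ge0.
have Ce := CcZ e Cchi.
have I_le s : Cc s -> (forall a, s a <= e * coverage l f0 a) ->
    I s <= e * I (coverage l f0).
  move=> Cs s_le; rewrite -IZpos // -subr_ge0 -IB //.
  by apply: (I_ge0 _ (CcB Ce Cs) _).1 => a; rewrite subr_ge0.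
rewrite ler_norml lerNl -IN //; apply/andP; split; apply: I_le => //.
- exact: CN.
- by move=> a; apply: le_trans (f_le a); rewrite -normrN; exact: ler_norm.
by move=> a; apply: le_trans (f_le a); exact: ler_norm.
Qed.

End HaarFunctional.

(** * Functions of class C^k *)

Lemma continuous_near_le (R : realType) (T : topologicalType) (f : T -> R) x
    (d : R) : 0 < d -> {for x, continuous f} ->
  \forall y \near x, `|f y - f x| <= d.
Proof. by move=> d0 cf; apply: cvgr_distC_le. Qed.

Lemma near_le_continuous (R : realType) (T : topologicalType) (f : T -> R) x :
  (forall d : R, 0 < d -> \forall y \near x, `|f y - f x| <= d) ->
  {for x, continuous f}.
Proof. by move=> H; apply/cvgrPdistC_le => d /H. Qed.

Lemma cvg_bigsum (R : realType) (I : Type) (r : seq I) (T : Type)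
    (F : set_system T) (f : I -> T -> R) (l : I -> R) : Filter F ->
  (forall i, f i x @[x --> F] --> l i) ->
  \sum_(i <- r) f i x @[x --> F] --> \sum_(i <- r) l i.
Proof.
move=> FF fl; elim: r => [|i r IH].
  under eq_fun do rewrite big_nil; rewrite big_nil; exact: cvg_cst.
under eq_fun do rewrite big_cons; rewrite big_cons.
exact: cvgD.
Qed.

Section DirectionalDerivative.
Context {R : realType} {V : normedModType R}.
Implicit Types (f : V -> R) (y v : V).

Lemma is_derive_line f y v (t : R) : derivable f (t *: v + y) v ->
  is_derive t 1 (fun h : R => f (h *: v + y)) ('D_v f (t *: v + y)).
Proof.
move=> df.
have E : (fun h : R => h^-1 *: (((fun h : R => f (h *: v + y)) \o shift t) (h *: 1)
      - f (t *: v + y))) =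
    (fun h : R => h^-1 *: ((f \o shift (t *: v + y)) (h *: v) - f (t *: v + y))).
  apply/funext => h /=; congr (_ *: (f _ - _)).
  by rewrite [h *: 1]mulr1 scalerDl addrA.
by split; rewrite /derivable /derive E.
Qed.

(** Locating [s] by [|s| <= |t|] treats both signs of [t] at once. *)
Lemma mean_value_line f y v (t : R) :
  (forall s : R, `|s| <= `|t| -> derivable f (s *: v + y) v) ->
  exists2 s : R, `|s| <= `|t| &
    f (t *: v + y) - f y = t * 'D_v f (s *: v + y).
Proof.
move=> df; pose phi (h : R) := f (h *: v + y).
have dphi (s : R) : `|s| <= `|t| -> is_derive s 1 phi ('D_v f (s *: v + y)).
  by move=> /df; exact: is_derive_line.
have cphi (a b : R) : (forall s, a <= s <= b -> `|s| <= `|t|) ->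
    {within `[a, b], continuous phi}.
  move=> H; apply: derivable_within_continuous => s; rewrite in_itv /= => /H st.
  by have [] := dphi s st.
have mvt (a b : R) : a <= b -> (forall s, a <= s <= b -> `|s| <= `|t|) ->
    exists2 s, `|s| <= `|t| & phi b - phi a = 'D_v f (s *: v + y) * (b - a).
  move=> ab H.
  have [s|s] := @MVT_segment R phi (fun s => 'D_v f (s *: v + y)) a b ab _ (cphi a b H).
    by rewrite in_itv /= => /andP[/ltW ? /ltW ?]; apply/dphi/H/andP.
  by rewrite in_itv /= => /H sH E; exists s.
have phi0 : phi 0 = f y by rewrite /phi scale0r add0r.
have [t0|t0] := leP 0 t.
  have [s /andP[s0 st]|s st E] := mvt 0 t t0; first by rewrite !ger0_norm.
  by exists s => //; rewrite -phi0 mulrC -[t in RHS]subr0.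
have [s /andP[ts s0]|s st E] := mvt t 0 (ltW t0).
  by rewrite !ler0_norm ?lerN2 // ltW.
by exists s => //; rewrite -phi0 -[LHS]opprB E sub0r mulrN opprK mulrC.
Qed.

Lemma nbhs0_normP (P : set V) :
  nbhs 0 P <-> exists2 r : R, 0 < r & forall v, `|v| < r -> P v.
Proof.
rewrite nbhs_ballP; split=> -[r r0 H]; exists r => // v; last first.
  by rewrite -ball_normE /= sub0r normrN; exact: H.
by move=> vr; apply: H; rewrite -ball_normE /= sub0r normrN.
Qed.

Lemma nbhs_shift0 (P : set V) x : nbhs x P -> nbhs 0 [set v | P (v + x)].
Proof.
have : v + x @[v --> (0 : V)] --> x; last exact.
by rewrite -[X in _ --> X]add0r; apply: cvgD; [exact: cvg_id | exact: cvg_cst].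
Qed.

End DirectionalDerivative.

Section RowNorm.
Context {R : realType} {n : nat}.
Implicit Types v w : 'rV[R]_n.

Lemma rV_norm_le v (c : R) : 0 <= c -> (forall i, `|v 0 i| <= c) -> `|v| <= c.
Proof.
move=> c0 H; rewrite /Num.norm/= mx_normrE; apply: bigmax_le => // -[i j] _ /=.
by rewrite (ord1 i).
Qed.

Lemma rV_coord_norm v i : `|v 0 i| <= `|v|.
Proof.
rewrite [leRHS]/Num.norm/= mx_normrE.
by apply: (le_bigmax _ (fun i : 'I_1 * 'I_n => `|v i.1 i.2|) (0, i)).
Qed.

End RowNorm.

Lemma coord_cvg (R : realType) (m n : nat) (T : Type) (F : set_system T)
    (u : T -> 'M[R]_(m, n)) (x : 'M[R]_(m, n)) i j : Filter F ->
  u @ F --> x -> u t i j @[t --> F] --> x i j.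
Proof.
move=> FF ux.
exact: (@cvg_comp _ _ _ u (fun M : 'M[R]_(m, n) => M i j) F (nbhs x) _ ux
  (@coord_continuous R m n i j x)).
Qed.

Section ContinuousPartials.
Context {R : realType} {n : nat}.
Implicit Types (f : 'rV[R]_n -> R) (x v : 'rV[R]_n).

(** The candidate for the differential of [f] at [x]; the codomain [R^o] makes it a linear map
    between modules. *)
Definition partial_sum f x v : R^o := \sum_i v 0 i * 'D_(delta_mx 0 i) f x.

Lemma partial_sum_linear f x : linear (partial_sum f x).
Proof.
move=> a u v; rewrite /partial_sum scaler_sumr -big_split /=.
by apply: eq_bigr => i _; rewrite !mxE mulrDl -mulrA.
Qed.

HB.instance Definition _ f x :=
  GRing.isLinear.Build R 'rV[R]_n R^o *:%R (partial_sum f x)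
    (partial_sum_linear f x).

Lemma partial_sum_continuous f x : continuous (partial_sum f x).
Proof.
move=> v; have H (T : Type) (F : set_system T) (FF : Filter F)
    (u : T -> 'rV[R]_n) (w : 'rV[R]_n) : u @ F --> w ->
    partial_sum f x (u t) @[t --> F] --> partial_sum f x w.
  move=> uw; apply: cvg_bigsum => i; apply: cvgM; last exact: cvg_cst.
  exact: coord_cvg.
exact: (H _ (nbhs (v : 'rV[R]_n)) (nbhs_filter _) id v (fun _ h => h)).
Qed.

(* Telescope along the coordinates; each step is the mean value theorem. *)
Lemma partial_sum_approx f x :
  (forall i, \forall y \near x, derivable f y (delta_mx 0 i)) ->
  (forall i, {for x, continuous (fun y => 'D_(delta_mx 0 i) f y)}) ->
  forall e : R, 0 < e -> \forall v \near (0 : 'rV[R]_n),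
    `|f (v + x) - f x - partial_sum f x v| <= e * `|v|.
Proof.
move=> df cf e e0.
(* Each of the [n] coordinate steps costs [d * |v|]; dividing by [n + 1] also covers [n = 0]. *)
pose d := e / (n.+1%:R).
have d0 : 0 < d by rewrite divr_gt0.
pose P (i : 'I_n) : set 'rV[R]_n := [set v |
    derivable f (v + x) (delta_mx 0 i) /\
    `|'D_(delta_mx 0 i) f (v + x) - 'D_(delta_mx 0 i) f x| <= d].
have nP i : nbhs (0 : 'rV[R]_n) (P i).
  have h1 := nbhs_shift0 (df i).
  have h2 := nbhs_shift0 (continuous_near_le d0 (cf i)).
  exact: (filterI h1 h2).
have [r r0 H] := (nbhs0_normP _).1 (filter_forall (nbhs_filter _) nP).
apply/nbhs0_normP; exists r => // v vr.
(* [w j] keeps the first [j] coordinates of [v]; in the sup norm all intermediate points stay within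
   [|v|] of 0. *)
pose w (j : nat) : 'rV[R]_n := \row_i (if (i < j)%N then v 0 i else 0).
have step (j : 'I_n) : `|f (w j.+1 + x) - f (w j + x)
    - v 0 j * 'D_(delta_mx 0 j) f x| <= d * `|v|.
  have wS : w j.+1 = v 0 j *: delta_mx 0 j + w j.
    apply/rowP => i; rewrite !mxE eqxx /= ltnS leq_eqVlt.
    case: (eqVneq i j) => [->|ij]; first by rewrite eqxx ltnn addr0 mulr1.
    by rewrite mulr0 add0r -[(_ == _ :> nat)]/(i == j) (negbTE ij).
  have small (s : R) : `|s| <= `|v 0 j| -> `|s *: delta_mx 0 j + w j| <= `|v|.
    move=> sv; apply: rV_norm_le => // i; rewrite !mxE eqxx /=.
    case: (eqVneq i j) => [->|ij].
      by rewrite ltnn addr0 mulr1 (le_trans sv) ?rV_coord_norm.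
    rewrite mulr0 add0r; case: ifP => _; first exact: rV_coord_norm.
    by rewrite normr0.
  have inball (s : R) : `|s| <= `|v 0 j| ->
      derivable f ((s *: delta_mx 0 j + w j) + x) (delta_mx 0 j) /\
      `|'D_(delta_mx 0 j) f ((s *: delta_mx 0 j + w j) + x)
        - 'D_(delta_mx 0 j) f x| <= d.
    move=> /small sv; exact: (H _ (le_lt_trans sv vr) j).
  have [s sv E] := @mean_value_line R _ f (w j + x) (delta_mx 0 j) (v 0 j)
    (fun s sv => ltac:(rewrite addrA; exact: (inball s sv).1)).
  rewrite wS -[_ *: _ + w j + x]addrA E -mulrBr normrM mulrC.
  by apply: ler_pM => //; [rewrite addrA; exact: (inball s sv).2
    | exact: rV_coord_norm].
have w0 : w 0 = 0 by apply/rowP => i; rewrite !mxE.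
have wn : w n = v by apply/rowP => i; rewrite !mxE ltn_ord.
have -> : f (v + x) - f x - partial_sum f x v =
    \sum_(j < n) (f (w j.+1 + x) - f (w j + x) - v 0 j * 'D_(delta_mx 0 j) f x).
  rewrite sumrB -(big_mkord xpredT (fun j => f (w j.+1 + x) - f (w j + x))).
  by rewrite telescope_sumr // w0 wn add0r.
apply: (le_trans (ler_norm_sum _ _ _)).
apply: (@le_trans _ _ (\sum_(j < n) d * `|v|)).
  by apply: ler_sum => j _; exact: step.
rewrite sumr_const card_ord -mulr_natr mulrAC ler_wpM2r//.
by rewrite /d mulrAC ler_pdivrMr // ler_wpM2l ?(ltW e0) // ler_nat.
Qed.

(** Bridges two notions: [Ck_on] speaks of partial derivatives, while the chain rule needs total
    differentiability. *)
Lemma continuous_partials_differentiable f x :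
  (forall i, \forall y \near x, derivable f y (delta_mx 0 i)) ->
  (forall i, {for x, continuous (fun y => 'D_(delta_mx 0 i) f y)}) ->
  differentiable (f : 'rV[R]_n -> R^o) x.
Proof.
move=> df cf.
have E : (f : _ -> R^o) \o shift x = cst (f x) + partial_sum f x +o_ (0 : 'rV[R]_n) id.
  apply/eqaddoP => e e0.
  have := partial_sum_approx df cf e0; apply: filterS => v.
  by rewrite /= !fctE opprD addrA.
have dE := diff_unique (partial_sum_continuous (x := x)) E.
apply/diff_locallyP; rewrite dE; split=> //.
exact: partial_sum_continuous.
Qed.

End ContinuousPartials.

Section ContinuousAt.
Context {R : realType} {T : topologicalType}.
Implicit Types (f g : T -> R) (x : T).

Lemma continuous_at_cst (S : topologicalType) (c : S) x :
  {for x, continuous (fun _ : T => c)}.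
Proof. exact: cvg_cst. Qed.

Lemma continuous_atD f g x : {for x, continuous f} -> {for x, continuous g} ->
  {for x, continuous (fun y => f y + g y)}.
Proof. by move=> cf cg; apply: cvgD; [exact: cf | exact: cg]. Qed.

Lemma continuous_atM f g x : {for x, continuous f} -> {for x, continuous g} ->
  {for x, continuous (fun y => f y * g y)}.
Proof. by move=> cf cg; apply: cvgM; [exact: cf | exact: cg]. Qed.

Lemma continuous_atV f x : f x != 0 -> {for x, continuous f} ->
  {for x, continuous (fun y => (f y)^-1)}.
Proof. by move=> fx0 cf; apply: cvgV => //; exact: cf. Qed.

End ContinuousAt.

Section CkCalculus.
Context {R : realType} {n : nat}.
Implicit Types (U V : set 'rV[R]_n) (f g : 'rV[R]_n -> R).

Lemma Ck_on_continuous k U f x : Ck_on k U f -> U x -> {for x, continuous f}.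
Proof. by case: k => [|k] [cf _]; exact: cf. Qed.

Lemma Ck_on_derivable k U f i x : Ck_on k.+1 U f -> U x ->
  derivable f x (delta_mx 0 i).
Proof. by move=> [_ /(_ i) [df _]]; exact: df. Qed.

Lemma Ck_on_partial k U f i : Ck_on k.+1 U f ->
  Ck_on k U (fun x => 'D_(delta_mx 0 i) f x).
Proof. by move=> [_ /(_ i) []]. Qed.

Lemma Ck_onS k U f : Ck_on k.+1 U f -> Ck_on k U f.
Proof.
elim: k f => [|k IH] f Cf; first by split=> // x Ux; exact: Ck_on_continuous Cf _.
split=> [x Ux|i]; first exact: Ck_on_continuous Cf Ux.
split=> [x Ux|]; first exact: Ck_on_derivable Cf Ux.
exact/IH/Ck_on_partial.
Qed.

Lemma Ck_on_sub k U V f : V `<=` U -> Ck_on k U f -> Ck_on k V f.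
Proof.
move=> VU; elim: k f => [|k IH] f Cf; split=> //.
- by move=> x /VU; exact: Ck_on_continuous Cf.
- by move=> x /VU; exact: Ck_on_continuous Cf.
move=> i; split=> [x /VU|]; first exact: Ck_on_derivable Cf.
exact/IH/Ck_on_partial.
Qed.

(** Each clause of [Ck_on] is a statement at one point about globally defined functions, so pieces
    glue point by point. *)
Lemma Ck_on_local k U f :
  (forall x, U x -> exists2 V, V x & Ck_on k V f) -> Ck_on k U f.
Proof.
elim: k f => [|k IH] f H; split=> //.
- by move=> x /H[V Vx Cf]; exact: Ck_on_continuous Cf Vx.
- by move=> x /H[V Vx Cf]; exact: Ck_on_continuous Cf Vx.
move=> i; split=> [x /H[V Vx Cf]|]; first exact: Ck_on_derivable Cf Vx.
by apply: IH => x /H[V Vx Cf]; exists V => //; exact: Ck_on_partial.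
Qed.

Lemma near_eq_continuous (T S : topologicalType) (u v : T -> S) x :
  (\forall y \near x, u y = v y) -> {for x, continuous u} ->
  {for x, continuous v}.
Proof.
move=> uv cu; have : v y @[y --> x] --> u x.
  by apply: cvg_trans cu; exact: near_eq_cvg.
by rewrite (nbhs_singleton uv).
Qed.

Lemma open_near_eq U f g x : open U -> (forall y, U y -> f y = g y) -> U x ->
  \forall y \near x, f y = g y.
Proof.
move=> oU fg Ux; have nU : nbhs x U by exact: open_nbhs_nbhs.
by apply: filterS nU => y /fg.
Qed.

(** On an open set equality passes to derivatives, although the total functions may differ
    outside. *)
Lemma Ck_on_ext k U f g : open U -> (forall x, U x -> f x = g x) ->
  Ck_on k U f -> Ck_on k U g.
Proof.
move=> oU; elim: k f g => [|k IH] f g fg Cf.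
  split=> // x Ux; apply: near_eq_continuous (Ck_on_continuous Cf Ux).
  exact: open_near_eq Ux.
split=> [x Ux|i].
  apply: near_eq_continuous (Ck_on_continuous Cf Ux); exact: open_near_eq Ux.
split=> [x Ux|].
  exact: (near_eq_derivable (open_near_eq oU fg Ux) (Ck_on_derivable Cf Ux)).
apply: IH (Ck_on_partial i Cf) => x Ux.
exact: (near_eq_derive _ (open_near_eq oU fg Ux)).
Qed.

Lemma Ck_on_cst k U (c : R) : Ck_on k U (fun=> c).
Proof.
elim: k c => [|k IH] c; split=> //; try by move=> x _; exact: continuous_at_cst.
move=> i; split=> [x _|]; first exact: derivable_cst.
have -> : (fun x => 'D_(delta_mx 0 i) (fun=> c) x) = (fun _ : 'rV[R]_n => 0).
  by apply/funext => x; exact: derive_cst.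
exact: IH.
Qed.

Lemma Ck_onD k U f g : open U -> Ck_on k U f -> Ck_on k U g ->
  Ck_on k U (fun x => f x + g x).
Proof.
move=> oU; elim: k f g => [|k IH] f g Cf Cg; split=> //.
- move=> x Ux; apply: continuous_atD; [exact: Ck_on_continuous Cf Ux
    | exact: Ck_on_continuous Cg Ux].
- move=> x Ux; apply: continuous_atD; [exact: Ck_on_continuous Cf Ux
    | exact: Ck_on_continuous Cg Ux].
move=> i; split=> [x Ux|].
  by apply: derivableD; [exact: Ck_on_derivable Cf Ux | exact: Ck_on_derivable Cg Ux].
apply: (@Ck_on_ext _ _ (fun x => 'D_(delta_mx 0 i) f x + 'D_(delta_mx 0 i) g x)) => //.
  move=> x Ux; rewrite -deriveD //; [exact: Ck_on_derivable Cf Ux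
    | exact: Ck_on_derivable Cg Ux].
by apply: IH; exact: Ck_on_partial.
Qed.

Lemma Ck_onM k U f g : open U -> Ck_on k U f -> Ck_on k U g ->
  Ck_on k U (fun x => f x * g x).
Proof.
move=> oU; elim: k f g => [|k IH] f g Cf Cg; split=> //.
- move=> x Ux; apply: continuous_atM; [exact: Ck_on_continuous Cf Ux
    | exact: Ck_on_continuous Cg Ux].
- move=> x Ux; apply: continuous_atM; [exact: Ck_on_continuous Cf Ux
    | exact: Ck_on_continuous Cg Ux].
move=> i; split=> [x Ux|].
  by apply: derivableM; [exact: Ck_on_derivable Cf Ux | exact: Ck_on_derivable Cg Ux].
apply: (@Ck_on_ext _ _ (fun x => f x * 'D_(delta_mx 0 i) g x +
    g x * 'D_(delta_mx 0 i) f x)) => //.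
  move=> x Ux; rewrite -[in LHS]/(_ *: _) -[g x * _]/(_ *: _) -deriveM //;
    [exact: Ck_on_derivable Cf Ux | exact: Ck_on_derivable Cg Ux].
by apply: Ck_onD => //; apply: IH; do ?[exact: Ck_on_partial|exact: Ck_onS].
Qed.

Lemma Ck_onV k U f : open U -> (forall x, U x -> f x != 0) -> Ck_on k U f ->
  Ck_on k U (fun x => (f x)^-1).
Proof.
move=> oU f0; elim: k => [|k IH] Cf.
  by split=> // x Ux; apply: continuous_atV; [exact: f0 | exact: Ck_on_continuous Cf Ux].
split=> [x Ux|i].
  by apply: continuous_atV; [exact: f0 | exact: Ck_on_continuous Cf Ux].
split=> [x Ux|].
  by apply: derivableV; [exact: f0 | exact: Ck_on_derivable Cf Ux].
have CV := IH (Ck_onS Cf).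
apply: (@Ck_on_ext _ _
  (fun x => (-1) * ((f x)^-1 * (f x)^-1) * 'D_(delta_mx 0 i) f x)) => //.
  move=> x Ux; rewrite deriveV; [|exact: f0|exact: Ck_on_derivable Cf Ux].
  by rewrite -[RHS]/(_ * _) expr2 invfM mulN1r.
apply: Ck_onM => //; last exact: Ck_on_partial.
by apply: Ck_onM => //; [exact: Ck_on_cst | exact: Ck_onM].
Qed.

Lemma Ck_on_sum (I : Type) (r : seq I) k U (F : I -> 'rV[R]_n -> R) : open U ->
  (forall i, Ck_on k U (F i)) -> Ck_on k U (fun x => \sum_(i <- r) F i x).
Proof.
move=> oU CF; elim: r => [|i r IH].
  by under eq_fun do rewrite big_nil; exact: Ck_on_cst.
by under eq_fun do rewrite big_cons; exact: Ck_onD.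
Qed.

Lemma Ck_on_differentiable k U f x : open U -> Ck_on k.+1 U f -> U x ->
  differentiable (f : _ -> R^o) x.
Proof.
move=> oU Cf Ux; apply: continuous_partials_differentiable => i.
  have nU : nbhs x U by exact: open_nbhs_nbhs.
  by apply: filterS nU => y; exact: Ck_on_derivable Cf.
exact: Ck_on_continuous (Ck_on_partial i Cf) Ux.
Qed.

End CkCalculus.

Section Composition.
Context {R : realType} {m n : nat}.
Implicit Types (f : 'rV[R]_m -> R) (g : 'rV[R]_n -> 'rV[R]_m).

Lemma differentiable_rV g x :
  (forall j, differentiable (fun y => g y 0 j : R^o) x) -> differentiable g x.
Proof.
move=> dg.
have -> : g = \sum_(j < m) (fun y => g y 0 j *: (delta_mx 0 j : 'rV[R]_m)).
  by apply/funext => y; rewrite fct_sumE -row_sum_delta.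
by apply: differentiable_sum => j; apply: differentiableZl; exact: dg.
Qed.

Lemma derive_rV_coord g x v j : differentiable g x ->
  ('D_v g x) 0 j = 'D_v (fun y => g y 0 j) x.
Proof. by move=> dg; rewrite derive_mx ?mxE //; exact: diff_derivable. Qed.

Lemma derive_comp_rV f g x v : differentiable (f : _ -> R^o) (g x) ->
  differentiable g x -> derivable (f \o g) x v /\
  'D_v (f \o g) x =
    \sum_j 'D_(delta_mx 0 j) f (g x) * 'D_v (fun y => g y 0 j) x.
Proof.
move=> df dg.
have dfg : differentiable ((f : _ -> R^o) \o g) x by exact: differentiable_comp.
split; first exact: (diff_derivable dfg).
have E1 : 'D_v (f \o g) x = 'd (f : _ -> R^o) (g x) ('D_v g x).
  by rewrite (deriveE v dfg) (diff_comp dg df) /= (deriveE v dg).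
rewrite E1 [X in 'd f (g x) X]row_sum_delta linear_sum; apply: eq_bigr => j _.
by rewrite linearZ derive_rV_coord // mulrC (deriveE _ df).
Qed.

(** By the chain rule a partial derivative of [f \o g] is a sum of products of functions of one
    order less, one factor being again a composition with [g]. *)
Lemma Ck_on_comp k (U : set 'rV[R]_n) (V : set 'rV[R]_m) f g :
  open U -> open V -> (forall x, U x -> V (g x)) ->
  (forall j, Ck_on k U (fun x => g x 0 j)) ->
  (forall x, U x -> {for x, continuous g}) ->
  Ck_on k V f -> Ck_on k U (f \o g).
Proof.
move=> oU oV UV + cg; elim: k f => [|k IH] f Cg Cf.
  split=> // x Ux; apply: continuous_comp; first exact: cg.
  exact: (Ck_on_continuous Cf (UV _ Ux)).
have dg x : U x -> differentiable g x.
  by move=> Ux; apply: differentiable_rV => j; exact: Ck_on_differentiable (Cg j) Ux.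
have df x : V x -> differentiable (f : _ -> R^o) x.
  by move=> Vx; exact: Ck_on_differentiable Cf Vx.
have dE x i : U x -> _ := fun Ux =>
  derive_comp_rV (delta_mx 0 i) (df _ (UV _ Ux)) (dg _ Ux).
split=> [x Ux|i].
  apply: continuous_comp; first exact: cg.
  exact: (Ck_on_continuous Cf (UV _ Ux)).
split=> [x Ux|]; first exact: (dE x i Ux).1.
apply: (@Ck_on_ext _ _ _ _ (fun x => \sum_j ('D_(delta_mx 0 j) f \o g) x *
    'D_(delta_mx 0 i) (fun y => g y 0 j) x)) => //.
  by move=> x Ux; rewrite (dE x i Ux).2.
apply: Ck_on_sum => // j; apply: Ck_onM => //.
  by apply: IH; [move=> l; exact: Ck_onS | exact: Ck_on_partial].
exact: Ck_on_partial.
Qed.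

End Composition.

(** * Bump functions on R^n *)

Section FlatFunction.
Context {R : realType}.
Implicit Types (m : nat) (t : R).

(* The functions t^-m exp(-1/t), extended by 0 to t <= 0, are stable under
   differentiation up to linear combinations. *)
Definition flat m t : R :=
  if 0 < t then t^-1 ^+ m * expR (- t^-1) else 0.

Definition flat_deriv m t : R := flat m.+2 t - m%:R * flat m.+1 t.

Lemma flat_ge0 m t : 0 <= flat m t.
Proof.
rewrite /flat; case: ltP => // t0.
by rewrite mulr_ge0 ?expR_ge0 // exprn_ge0 // invr_ge0 ltW.
Qed.

(** Comes from the term of order m + 2 in the series of exp(1/t). The factor [t ^+ 2] makes the
    difference quotient at 0 tend to 0. *)
Lemma flat_le m t : 0 < t -> flat m t <= (m.+2)`!%:R * t ^+ 2.
Proof.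
move=> t0; rewrite /flat t0 expRN ler_pdivrMr ?expR_gt0 //.
have := @expR_ge1Dxn R t^-1 m.+1 (ltW (_ : 0 < t^-1)); rewrite invr_gt0 => /(_ t0) h.
have h1 : t^-1 ^+ m.+2 <= (m.+2)`!%:R * expR t^-1.
  rewrite mulrC -ler_pdivrMr ?ltr0n ?fact_gt0 //.
  by apply: le_trans h; rewrite lerDr.
have -> : t^-1 ^+ m = t^-1 ^+ m.+2 * t ^+ 2.
  by rewrite -addn2 exprD -mulrA -exprMn mulVf ?gt_eqF // expr1n mulr1.
by rewrite [leRHS]mulrAC ler_wpM2r // sqr_ge0.
Qed.

Lemma is_derive_flat m t : is_derive t 1 (flat m) (flat_deriv m t).
Proof.
have [t0|t0|->] := ltgtP t 0.
- have -> : flat_deriv m t = 0.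
    by rewrite /flat_deriv /flat !ltNge (ltW t0) /= mulr0 subr0.
  have E : \forall s \near t, (cst 0 : R -> R) s = flat m s.
    near=> s; rewrite /flat ltNge; suff -> : s <= 0 by [].
    by apply: ltW; near: s; exact: lt_nbhsl.
  exact: (near_eq_is_derive E (is_derive_cst _ _ _)).
- have -> : flat_deriv m t = t^-1 ^+ m * (expR (- t^-1) * t ^- 2) +
      expR (- t^-1) * (m%:R * t^-1 ^+ m.-1 * - t ^- 2).
    rewrite /flat_deriv /flat t0 -exprVn; case: m => [|m] /=; first by ring.
    by rewrite !exprS; ring.
  have t'0 : (id : R -> R) t != 0 by rewrite gt_eqF.
  have dV : is_derive t 1 (fun s : R => s^-1) (- t ^- 2).
    by have := is_deriveV t'0 (is_derive_id t 1); rewrite [_ *: 1]mulr1.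
  have dX := is_deriveX m dV.
  have dE := @is_derive1_comp R expR (- (fun s : R => s^-1)) t _ _
    (is_derive_expR (- t^-1)) (is_deriveN dV).
  have := is_deriveM dX dE; rewrite opprK => dM.
  have E : \forall s \near t, ((fun s : R => s^-1) ^+ m *
      (expR \o - (fun s : R => s^-1))) s = flat m s.
    near=> s; rewrite /flat; have -> : 0 < s by near: s; exact: lt_nbhsr.
    by rewrite -[LHS]/(((fun s : R => s^-1) ^+ m) s * expR (- s^-1)) exprfctE.
  by have := near_eq_is_derive E dM; rewrite exprfctE.
(* At the junction the quotient is 0 on the left and at most (m + 2)! h on the right. *)
have -> : flat_deriv m 0 = 0 by rewrite /flat_deriv /flat ltxx mulr0 subr0.
have lim0 : h^-1 *: ((flat m \o shift 0) (h *: 1) - flat m 0) @[h --> 0^'] --> (0 : R).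
  apply/cvgr0Pnorm_le => e e0; near=> h.
  have -> : flat m 0 = 0 by rewrite /flat ltxx.
  rewrite /= subr0 addr0 [h *: 1]mulr1 normrM normfV.
  have [h0|h0] := ltP 0 h; last first.
    by rewrite /flat ltNge h0 /= normr0 mulr0 ltW.
  rewrite (ger0_norm (flat_ge0 _ _)) gtr0_norm // ler_pdivrMl //.
  apply: (le_trans (flat_le m h0)).
  rewrite expr2 mulrA [leRHS]mulrC ler_wpM2r ?ltW //.
  rewrite -ltr_pdivlMl ?ltr0n ?fact_gt0 //.
  apply: (le_lt_trans (ler_norm _)).
  by near: h; apply: dnbhs0_lt; rewrite mulr_gt0 // invr_gt0 ltr0n fact_gt0.
split; first by apply/cvg_ex; exists 0.
exact: cvg_lim lim0.
Unshelve. all: by end_near. Qed.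

(** The induction on [k] runs over all [m] together, since differentiating [flat m] brings in
    [flat m.+1] and [flat m.+2]. *)
Lemma Ck_on_flat n (U : set 'rV[R]_n) (q : 'rV[R]_n -> R) k m : open U ->
  Ck_on k U q -> Ck_on k U (fun x => flat m (q x)).
Proof.
move=> oU; elim: k m => [|k IH] m Cq.
  split=> // x Ux; apply: continuous_comp; first exact: Ck_on_continuous Cq Ux.
  apply: differentiable_continuous; apply/derivable1_diffP.
  by have [] := is_derive_flat m (q x).
have dflat t : differentiable (flat m) t.
  by apply/derivable1_diffP; have [] := is_derive_flat m t.
have dq x : U x -> differentiable (q : _ -> R^o) x.
  by move=> Ux; exact: Ck_on_differentiable Cq Ux.
have dc x : U x -> differentiable ((flat m : R -> R^o) \o (q : _ -> R^o)) x.
  by move=> Ux; apply: differentiable_comp; [exact: dq | exact: dflat].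
split=> [x Ux|i].
  apply: continuous_comp; first exact: Ck_on_continuous Cq Ux.
  exact: differentiable_continuous.
split=> [x Ux|]; first exact: (diff_derivable (dc x Ux)).
apply: (@Ck_on_ext _ _ _ _ (fun x => (flat m.+2 (q x) + (- m%:R) * flat m.+1 (q x))
    * 'D_(delta_mx 0 i) q x)) => //.
  move=> x Ux; rewrite (deriveE _ (dc x Ux)) (diff_comp (dq x Ux) (dflat _)) /=.
  rewrite -(deriveE _ (dq x Ux)); set w : R := 'D__ q x.
  have -> : 'd (flat m) (q x) w = w * 'D_1 (flat m) (q x).
    by rewrite (deriveE (1 : R^o) (dflat _)) -[w in LHS]mulr1; exact: linearZ.
  by have [_ ->] := is_derive_flat m (q x); rewrite /flat_deriv mulNr mulrC.
apply: Ck_onM => //; last exact: Ck_on_partial.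
apply: Ck_onD => //; first by apply: IH; exact: Ck_onS.
by apply: Ck_onM => //; [exact: Ck_on_cst | apply: IH; exact: Ck_onS].
Qed.

End FlatFunction.

Section CoordinatesAndBumps.
Context {R : realType} {n : nat}.

Lemma rV_id_differentiable (x : 'rV[R]_n) :
  differentiable (fun y : 'rV[R]_n => y) x.
Proof.
apply: differentiable_rV => j; exact: (@differentiable_coord R 1 n x 0 j).
Qed.

Lemma Ck_on_coord k (U : set 'rV[R]_n) j : Ck_on k U (fun x => x 0 j).
Proof.
have cc x : {for x, continuous (fun x : 'rV[R]_n => x 0 j)}.
  exact: (@coord_continuous R 1 n 0 j x).
case: k => [|k]; first by split=> // x _; exact: cc.
split=> [x _|i]; first exact: cc.
split=> [x _|].
  exact: (diff_derivable (@differentiable_coord R 1 n x 0 j)).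
have -> : (fun x : 'rV[R]_n => 'D_(delta_mx 0 i) (fun y : 'rV[R]_n => y 0 j) x) =
    (fun=> (delta_mx 0 i : 'rV[R]_n) 0 j).
  apply/funext => x; rewrite -(derive_rV_coord _ _ (rV_id_differentiable x)).
  by rewrite derive_id.
exact: Ck_on_cst.
Qed.

(** The squared Euclidean distance is a polynomial, unlike the sup norm of row vectors; the
    Euclidean ball lies in the sup-norm ball of the same radius. *)
Definition bump_rV (y0 : 'rV[R]_n) (r : R) (y : 'rV[R]_n) : R :=
  flat 0 (r ^+ 2 - \sum_j (y 0 j - y0 0 j) * (y 0 j - y0 0 j)).

Lemma bump_rV_smooth y0 r : smooth_fun_on setT (bump_rV y0 r).
Proof.
move=> k; apply: Ck_on_flat; first exact: openT.
have CB j : Ck_on k setT (fun y : 'rV[R]_n => y 0 j - y0 0 j).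
  by apply: (Ck_onD openT); [exact: Ck_on_coord | exact: Ck_on_cst].
have -> : (fun y : 'rV[R]_n =>
      r ^+ 2 - \sum_j (y 0 j - y0 0 j) * (y 0 j - y0 0 j)) =
    (fun y => r ^+ 2 + (-1) * \sum_j (y 0 j - y0 0 j) * (y 0 j - y0 0 j)).
  by apply/funext => y; rewrite mulN1r.
apply: (Ck_onD openT); first exact: Ck_on_cst.
apply: (Ck_onM openT); first exact: Ck_on_cst.
by apply: (Ck_on_sum _ openT) => j; exact: (Ck_onM openT).
Qed.

Lemma bump_rV_ge0 y0 r y : 0 <= bump_rV y0 r y.
Proof. exact: flat_ge0. Qed.

Lemma bump_rV_gt0 y0 r : 0 < r -> 0 < bump_rV y0 r y0.
Proof.
move=> r0; rewrite /bump_rV big1 => [|j _]; last by rewrite subrr mul0r.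
by rewrite subr0 /flat exprn_gt0 // expr0 mul1r expR_gt0.
Qed.

Lemma bump_rV_support y0 r y : 0 < r -> bump_rV y0 r y != 0 -> `|y - y0| <= r.
Proof.
move=> r0; rewrite /bump_rV /flat; case: ifP => [+ _|_]; last by rewrite eqxx.
rewrite subr_gt0 => sr; apply: rV_norm_le => [|j]; first exact: ltW.
rewrite -(@ler_pXn2r _ 2%N) ?nnegrE ?(ltW r0) //.
apply: le_trans (ltW sr); rewrite (bigD1 j) //= !mxE real_normK ?num_real //.
rewrite expr2 lerDl; apply: sumr_ge0 => i _; rewrite -expr2; exact: sqr_ge0.
Qed.

End CoordinatesAndBumps.

(** * Differentiation under a functional *)

Section ParameterDerivative.
Context {R : realType} {n : nat} {X : topologicalType}.
Implicit Types (O : set (X * 'rV[R]_n)) (W : set 'rV[R]_n)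
  (Phi : X -> 'rV[R]_n -> R).

(* C^k in the second variable, with derivatives jointly continuous in both. *)
Fixpoint Ck_param k O Phi : Prop :=
  (forall p, O p -> {for p, continuous (fun p => Phi p.1 p.2)}) /\
  (if k is k'.+1 then
     forall i : 'I_n,
       (forall p, O p -> derivable (Phi p.1) p.2 (delta_mx 0 i)) /\
       Ck_param k' O (fun a y => 'D_(delta_mx 0 i) (Phi a) y)
   else True).

Lemma Ck_param_continuous k O Phi p : Ck_param k O Phi -> O p ->
  {for p, continuous (fun p => Phi p.1 p.2)}.
Proof. by case: k => [|k] [cf _]; exact: cf. Qed.

Lemma Ck_param_local k O Phi :
  (forall p, O p -> exists2 Q, Q p & Ck_param k Q Phi) -> Ck_param k O Phi.
Proof.
elim: k Phi => [|k IH] Phi H; split=> //.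
- by move=> p /H[Q Qp C]; exact: Ck_param_continuous C Qp.
- by move=> p /H[Q Qp C]; exact: Ck_param_continuous C Qp.
move=> i; split=> [p /H[Q Qp [_ /(_ i) [d _]]]|]; first exact: d.
by apply: IH => p /H[Q Qp [_ /(_ i) [_ C]]]; exists Q.
Qed.

(** A tube lemma: joint continuity along the compact set [K] x {y} gives smallness uniform in the
    parameter. *)
Lemma partial_uniform Phi K y : compact K ->
  (forall a, K a -> {for (a, y), continuous (fun p => Phi p.1 p.2)}) ->
  forall e : R, 0 < e ->
    \forall z \near y, forall a, K a -> `|Phi a z - Phi a y| <= e.
Proof.
move=> cK cPhi e e0.
have := (compact_near_coveringP K).1 cK _ (nbhs y)
  (fun z a => `|Phi a z - Phi a y| <= e) (nbhs_filter _).
move=> H; have {H} : \forall z \near y, K `<=` (fun a => `|Phi a z - Phi a y| <= e).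
  apply: H => a Ka; have e2 : 0 < e / 2 by rewrite divr_gt0.
  have near1 := continuous_near_le e2 (cPhi a Ka).
  have near2 : \forall b \near a, `|Phi b y - Phi a y| <= e / 2.
    have /(_ _ near1) : (b, y) @[b --> a] --> (a, y).
      exact: (cvg_pair cvg_id (cvg_cst _)).
    exact.
  have near2' : \forall p \near (a, y), `|Phi p.1 y - Phi a y| <= e / 2.
    exact: (@cvg_fst _ _ (nbhs a) (nbhs y) _ _ near2).
  apply: filterS2 near1 near2' => -[b z] /= h1 h2.
  rewrite -(subrKA (Phi a y)) (le_trans (ler_normD _ _)) // (splitr e) lerD //.
  by rewrite distrC.
by apply: filterS => z H a /H.
Qed.

Variable I : (X -> R) -> R.
Hypothesis IB : forall f g, Cc f -> Cc g -> I (fun a => f a - g a) = I f - I g.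
Hypothesis IZ : forall (c : R) f, Cc f -> I (fun a => c * f a) = c * I f.
Hypothesis Ibound : forall K, compact K -> exists C, forall f (e : R), Cc f ->
  (forall a, ~ K a -> f a = 0) -> (forall a, `|f a| <= e) -> `|I f| <= e * C.

Section FixedSupport.
Variables (K : set X) (W : set 'rV[R]_n).
Hypotheses (cK : compact K) (oW : open W).

Let slice_Cc Phi y : W y ->
  (forall p, W p.2 -> {for p, continuous (fun p => Phi p.1 p.2)}) ->
  (forall a y, ~ K a -> W y -> Phi a y = 0) -> Cc (fun a => Phi a y).
Proof.
move=> Wy cPhi PhiK; split; last by exists K => // a Ka; exact: PhiK.
move=> a; have ca : {for (a, y), continuous (fun p => Phi p.1 p.2)} by exact: cPhi.
apply: (@continuous_comp _ _ _ (fun b => (b, y)) (fun p => Phi p.1 p.2)) => //.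
exact: (cvg_pair cvg_id (cvg_cst _)).
Qed.

(** A positive constant lets [e / C] serve as tolerance, and the bound has to be tested on [K]
    only. *)
Let Ibound' : exists2 C : R, 0 < C & forall f (e : R), Cc f -> 0 <= e ->
  (forall a, ~ K a -> f a = 0) -> (forall a, K a -> `|f a| <= e) ->
  `|I f| <= e * C.
Proof.
have [C HC] := Ibound cK; exists (`|C| + 1); first by rewrite ltr_wpDl.
move=> f e Cf e0 fK fe; apply: (@le_trans _ _ (e * C)).
  apply: HC => // a; have [/fe//|/fK ->] := pselect (K a).
  by rewrite normr0.
by rewrite ler_wpM2l // (le_trans (ler_norm _)) // lerDl.
Qed.

Lemma functional_continuous Phi y : W y ->
  (forall p, W p.2 -> {for p, continuous (fun p => Phi p.1 p.2)}) ->
  (forall a y, ~ K a -> W y -> Phi a y = 0) ->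
  {for y, continuous (fun y => I (fun a => Phi a y))}.
Proof.
move=> Wy cPhi PhiK; have [C C0 HC] := Ibound'.
apply: near_le_continuous => e e0.
have eC : 0 < e / C by rewrite divr_gt0.
have near1 := partial_uniform cK (fun a _ => cPhi (a, y) Wy) eC.
have nW : nbhs y W by exact: open_nbhs_nbhs.
apply: filterS2 nW near1 => z Wz h.
have Cz := slice_Cc Wz cPhi PhiK; have Cy := slice_Cc Wy cPhi PhiK.
rewrite -IB // -[e](@divfK _ C) ?gt_eqF //; apply: HC => //; first exact: CcB.
  exact: ltW.
by move=> a Ka; rewrite !PhiK // subrr.
Qed.

(** For each [a] in [K] the difference quotient is a derivative at an intermediate point. That point
    depends on [a], so closeness of the derivatives must be uniform over [K] before [I] can be
    estimated. *)
Lemma functional_is_derive Phi y i : W y ->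
  (forall p, W p.2 -> {for p, continuous (fun p => Phi p.1 p.2)}) ->
  (forall a y, ~ K a -> W y -> Phi a y = 0) ->
  (forall p, W p.2 -> derivable (Phi p.1) p.2 (delta_mx 0 i)) ->
  (forall p, W p.2 -> {for p, continuous
     (fun p : X * 'rV[R]_n => 'D_(delta_mx 0 i) (Phi p.1) p.2)}) ->
  (forall a y, ~ K a -> W y -> 'D_(delta_mx 0 i) (Phi a) y = 0) ->
  is_derive y (delta_mx 0 i) (fun y => I (fun a => Phi a y))
    (I (fun a => 'D_(delta_mx 0 i) (Phi a) y)).
Proof.
move=> Wy cPhi PhiK dPhi cD DK; have [C C0 HC] := Ibound'.
pose F z := I (fun a => Phi a z).
set L := I (fun a => _).
have Cy := slice_Cc Wy cPhi PhiK.
have CD := @slice_Cc (fun a z => 'D_(delta_mx 0 i) (Phi a) z) y Wy cD DK.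
suff H : h^-1 *: ((F \o shift y) (h *: delta_mx 0 i) - F y) @[h --> 0^'] --> L.
  by split; [apply/cvg_ex; exists L | exact: cvg_lim H].
apply/cvgrPdistC_le => e e0.
have eC : 0 < e / C by rewrite divr_gt0.
have near1 := partial_uniform (Phi := fun a z => 'D_(delta_mx 0 i) (Phi a) z) cK
  (fun a _ => cD (a, y) Wy) eC.
have nW : nbhs y W by exact: open_nbhs_nbhs.
have [r r0 Hr] := (nbhs0_normP _).1 (nbhs_shift0 (filterI nW near1)).
have small (s : R) : `|s| < r -> `|s *: (delta_mx 0 i : 'rV[R]_n)| < r.
  move=> sr; apply: le_lt_trans sr; apply: rV_norm_le => // j.
  rewrite !mxE eqxx /=; case: (_ == _); first by rewrite mulr1.
  by rewrite mulr0 normr0.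
near=> h.
have h0 : h != 0 by near: h; exact: nbhs_dnbhs_neq.
have hr : `|h| < r by near: h; exact: dnbhs0_lt.
have [Wh _] := Hr _ (small _ hr).
have Ch := slice_Cc Wh cPhi PhiK.
rewrite /F /= -[h^-1 *: _]/(h^-1 * _) -IB // -IZ; last exact: CcB.
rewrite -IB //; last exact/CcZ/CcB.
rewrite -[e](@divfK _ C) ?gt_eqF //; apply: HC.
- by apply: CcB => //; exact/CcZ/CcB.
- exact: ltW.
- by move=> a Ka; rewrite !PhiK // DK // !subrr mulr0 subrr.
move=> a Ka.
have [|s sh ->] := @mean_value_line R _ (Phi a) y (delta_mx 0 i) h.
  move=> s sh; apply: (dPhi (a, _)).
  exact: (Hr _ (small _ (le_lt_trans sh hr))).1.
rewrite mulKf //.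
exact: (Hr _ (small _ (le_lt_trans sh hr))).2.
Unshelve. all: by end_near. Qed.

Lemma functional_Ck k Phi : Ck_param k [set p | W p.2] Phi ->
  (forall a y, ~ K a -> W y -> Phi a y = 0) ->
  Ck_on k W (fun y => I (fun a => Phi a y)).
Proof.
elim: k Phi => [|k IH] Phi CP PhiK; split=> //.
- by move=> y Wy; apply: functional_continuous => // p Wp;
    exact: Ck_param_continuous CP Wp.
- by move=> y Wy; apply: functional_continuous => // p Wp;
    exact: Ck_param_continuous CP Wp.
move=> i; have [cP /(_ i) [dP CDP]] := CP.
(* Vanishing on the open set [W] is inherited by the derivative, so the induction keeps the same
   [K]. *)
have DK a y : ~ K a -> W y -> 'D_(delta_mx 0 i) (Phi a) y = 0.
  move=> Ka Wy; rewrite -(derive_cst (0 : R^o) y (delta_mx 0 i)).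
  apply: near_eq_derive; have nW : nbhs y W by exact: open_nbhs_nbhs.
  by apply: filterS nW => z Wz; exact: PhiK.
have dI y (Wy : W y) := functional_is_derive Wy cP PhiK dP
  (fun p => Ck_param_continuous CDP) DK.
split=> [y Wy|]; first by have [] := dI y Wy.
apply: (Ck_on_ext oW _ (IH _ CDP DK)) => y Wy.
by have [_ ->] := dI y Wy.
Qed.

End FixedSupport.

End ParameterDerivative.

Lemma nbhs_slice (X Y : topologicalType) (Q : set (X * Y)) (a : X)
    (y : Y) :
  nbhs (a, y) Q -> nbhs y [set z | Q (a, z)].
Proof.
have : (a, z) @[z --> y] --> (a, y) by exact: (cvg_pair (cvg_cst _) cvg_id).
exact.
Qed.

(** * Block coordinates on a product *)

Section RowBlocks.
Context {R : realType}.

Lemma cvg_rV n (T : Type) (F : set_system T) (u : T -> 'rV[R]_n)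
    (x : 'rV[R]_n) : Filter F ->
  (forall j, u t 0 j @[t --> F] --> x 0 j) -> u @ F --> x.
Proof.
move=> FF ux; apply/cvgrPdistC_le => e e0.
have H j : F [set t | `|u t 0 j - x 0 j| <= e].
  by have /cvgr_distC_le := ux j; apply.
apply: filterS (filter_forall FF H) => t Ht.
by apply: rV_norm_le => [|j]; [exact: ltW | rewrite !mxE; exact: Ht].
Qed.

Lemma cvg_row_mx m n (T : Type) (F : set_system T) (u : T -> 'rV[R]_m)
    (v : T -> 'rV[R]_n) (x : 'rV[R]_m) (y : 'rV[R]_n) : Filter F ->
  u @ F --> x -> v @ F --> y ->
  (fun t => row_mx (u t) (v t)) @ F --> row_mx x y.
Proof.
move=> FF ux vy; apply: cvg_rV => j; case: (splitP j) => [i|i] ji.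
  have -> : j = lshift n i by apply: val_inj.
  by under eq_fun do rewrite row_mxEl; rewrite row_mxEl; exact: coord_cvg.
have -> : j = rshift m i by apply: val_inj.
by under eq_fun do rewrite row_mxEr; rewrite row_mxEr; exact: coord_cvg.
Qed.

Lemma cvg_lsubmx m n (T : Type) (F : set_system T) (u : T -> 'rV[R]_(m + n))
    (x : 'rV[R]_(m + n)) :
  Filter F -> u @ F --> x -> (fun t => lsubmx (u t)) @ F --> lsubmx x.
Proof.
move=> FF ux; apply: cvg_rV => j; under eq_fun do rewrite mxE.
by rewrite mxE; exact: coord_cvg.
Qed.

Lemma cvg_rsubmx m n (T : Type) (F : set_system T) (u : T -> 'rV[R]_(m + n))
    (x : 'rV[R]_(m + n)) :
  Filter F -> u @ F --> x -> (fun t => rsubmx (u t)) @ F --> rsubmx x.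
Proof.
move=> FF ux; apply: cvg_rV => j; under eq_fun do rewrite mxE.
by rewrite mxE; exact: coord_cvg.
Qed.

Lemma row_mx_line m n (s : 'rV[R]_m) (y : 'rV[R]_n) i (h : R) :
  row_mx s (h *: delta_mx 0 i + y) = h *: delta_mx 0 (rshift m i) + row_mx s y.
Proof.
apply/rowP => j; case: (splitP j) => [l|l] jl.
  have -> : j = lshift n l by apply: val_inj.
  by rewrite row_mxEl [RHS]mxE row_mxEl !mxE eqxx /= eq_lrshift mulr0 add0r.
have -> : j = rshift m l by apply: val_inj.
by rewrite row_mxEr [RHS]mxE row_mxEr !mxE eqxx /= eq_rshift.
Qed.

Lemma derive_row_mx m n (Psi : 'rV[R]_(m + n) -> R) s y i :
  (derivable Psi (row_mx s y) (delta_mx 0 (rshift m i)) ->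
   derivable (fun z : 'rV[R]_n => Psi (row_mx s z)) y (delta_mx 0 i)) /\
  'D_(delta_mx 0 i) (fun z : 'rV[R]_n => Psi (row_mx s z)) y =
  'D_(delta_mx 0 (rshift m i)) Psi (row_mx s y).
Proof.
have E : (fun h : R => h^-1 *: (((fun z : 'rV[R]_n => Psi (row_mx s z)) \o
      shift y) (h *: delta_mx 0 i) - Psi (row_mx s y))) =
    (fun h : R => h^-1 *: ((Psi \o shift (row_mx s y))
      (h *: delta_mx 0 (rshift m i)) - Psi (row_mx s y))).
  by apply/funext => h; rewrite /= row_mx_line.
by rewrite /derivable /derive E.
Qed.

Context {n : nat} {X : topologicalType}.

Lemma Ck_param_sub k (Q S : set (X * 'rV[R]_n)) Phi : Q `<=` S ->
  Ck_param k S Phi -> Ck_param k Q Phi.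
Proof.
by move=> QS C; apply: Ck_param_local => p /QS Sp; exists S.
Qed.

(** Passes from joint smoothness in product coordinates to smoothness with a parameter: partial
    derivatives of a slice are those of [Psi] in the last [n] directions, and the parameter enters
    through a continuous [iota]. *)
Lemma Ck_param_row_mx m k (U : set 'rV[R]_(m + n)) (Q : set (X * 'rV[R]_n))
    (iota : X -> 'rV[R]_m) Phi Psi : open Q ->
  (forall p, Q p -> {for p.1, continuous iota}) ->
  (forall p, Q p -> U (row_mx (iota p.1) p.2)) ->
  (forall p, Q p -> Phi p.1 p.2 = Psi (row_mx (iota p.1) p.2)) ->
  Ck_on k U Psi -> Ck_param k Q Phi.
Proof.
move=> oQ ci QU; elim: k Phi Psi => [|k IH] Phi Psi PhiE CPsi.
  split=> // p Qp.
  apply: (@near_eq_continuous _ _ (fun p : X * 'rV[R]_n => Psi (row_mx (iota p.1) p.2))).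
    have nQ : nbhs p Q by exact: open_nbhs_nbhs.
    by apply: filterS nQ => q /PhiE.
  apply: (@cvg_comp _ _ _ (fun p : X * 'rV[R]_n => row_mx (iota p.1) p.2) Psi).
    apply: cvg_row_mx; last exact: cvg_snd.
    apply: (@cvg_comp _ _ _ fst iota); [exact: cvg_fst | exact: ci].
  exact: (Ck_on_continuous CPsi (QU _ Qp)).
have slice a y : Q (a, y) -> \forall z \near y, Psi (row_mx (iota a) z) = Phi a z.
  move=> Qp; have nQ : nbhs (a, y) Q by exact: open_nbhs_nbhs.
  by apply: filterS (nbhs_slice nQ) => z /PhiE.
have C0 := IH _ _ PhiE (Ck_onS CPsi).
split=> [p Qp|i]; first exact: Ck_param_continuous C0 Qp.
split=> [[a y] Qp|].
  apply: (near_eq_derivable (slice a y Qp)).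
  exact: (derive_row_mx Psi (iota a) y i).1 (Ck_on_derivable CPsi (QU _ Qp)).
apply: IH (Ck_on_partial (rshift m i) CPsi) => -[a y] Qp /=.
rewrite -(near_eq_derive _ (slice a y Qp)).
exact: (derive_row_mx Psi (iota a) y i).2.
Qed.

End RowBlocks.

(** * Charts and the tangent map *)

Section JacobianChain.
Context {R : realType}.

Lemma mul_jacobian m n (f : 'rV[R]_m -> 'rV[R]_n) p (v : 'rV[R]_m) :
  v *m jacobian f p = 'd f p v.
Proof. by rewrite /jacobian mul_rV_lin1. Qed.

(** Composites of charts and inverse charts simplify only near a point, hence the equality of germs
    instead of functions. *)
Lemma jacobian_chain l m n (f : 'rV[R]_l -> 'rV[R]_m) (g : 'rV[R]_m -> 'rV[R]_n)
    (h : 'rV[R]_l -> 'rV[R]_n) p (v : 'rV[R]_l) :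
  differentiable f p -> differentiable g (f p) -> differentiable h p ->
  (\forall y \near p, g (f y) = h y) ->
  v *m jacobian f p *m jacobian g (f p) = v *m jacobian h p.
Proof.
move=> df dg dh E; rewrite !mul_jacobian -(deriveE v dh).
have dgf : differentiable (g \o f) p by exact: differentiable_comp.
rewrite -(near_eq_derive v (f := g \o f) E) (deriveE v dgf).
by rewrite (diff_comp df dg).
Qed.

End JacobianChain.

Section Charts.
Context {R : realType} {n : nat} {M : manifoldType R n}.
Implicit Types (c : chart R n M) (x : M) (A : set M).

Lemma chart_at_atlas x : atlas (chart_at x).
Proof. by rewrite /chart_at; case: (cid2 _). Qed.

Lemma chart_at_dom x : chart_dom (chart_at x) x.
Proof. by rewrite /chart_at; case: (cid2 _). Qed.

Lemma chart_img_inv c y : (c @` chart_dom c) y ->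
  chart_dom c (chart_inv c y) /\ c (chart_inv c y) = y.
Proof. by move=> [x dx <-]; rewrite chart_funK. Qed.

Lemma nbhs_chart_dom c x : chart_dom c x -> nbhs x (chart_dom c).
Proof. by move=> dx; apply: open_nbhs_nbhs; split=> //; exact: chart_dom_open. Qed.

Lemma nbhs_chart_img c x A : chart_dom c x -> nbhs x A ->
  \forall y \near c x, [/\ chart_dom c (chart_inv c y),
    A (chart_inv c y) & c (chart_inv c y) = y].
Proof.
move=> dx nA.
have n1 : nbhs (c x) (c @` chart_dom c).
  by apply: open_nbhs_nbhs; split; [exact: chart_img_open | exists x].
have n2 : \forall y \near c x, A (chart_inv c y).
  have ci : chart_inv c y @[y --> c x] --> chart_inv c (c x).
    exact: (@chart_inv_continuous _ _ _ c x dx).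
  by rewrite chart_funK // in ci; exact: ci.
by apply: filterS2 n1 n2 => y /chart_img_inv[d1 d2] Ay.
Qed.

Lemma chart_img_sub_open c A : open A -> open (c @` (chart_dom c `&` A)).
Proof.
move=> oA; rewrite openE => y [x [dx Ax] <-].
have nA : nbhs x A by exact: open_nbhs_nbhs.
apply: filterS (nbhs_chart_img dx nA) => z [d1 d2 E].
by exists (chart_inv c z).
Qed.

Lemma smooth_map_differentiable (f : M -> M) c c' x : smooth_map f ->
  atlas c -> atlas c' -> chart_dom c x -> chart_dom c' (f x) ->
  differentiable (c' \o f \o chart_inv c) (c x).
Proof.
move=> [cf sf] ac ac' dx dfx; apply: differentiable_rV => j.
have oA : open (f @^-1` chart_dom c').
  by apply: open_comp => [y _|]; [exact: cf | exact: chart_dom_open].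
have Ux : (c @` (chart_dom c `&` f @^-1` chart_dom c')) (c x) by exists x.
exact: (Ck_on_differentiable (chart_img_sub_open oA) (sf _ _ ac ac' j 1%N) Ux).
Qed.

(** Makes chart transitions an instance of [smooth_map_differentiable]. *)
Lemma id_smooth : smooth_map (@id M).
Proof.
split=> [x|c c' ac ac']; first exact: cvg_id.
exact: atlas_compatible.
Qed.

Lemma chart_transition_differentiable c c' x : atlas c -> atlas c' ->
  chart_dom c x -> chart_dom c' x ->
  differentiable (c' \o chart_inv c) (c x).
Proof. exact: (smooth_map_differentiable id_smooth). Qed.

(* The tangent vector at x with coordinates w in the chart c. *)
Definition chart_vector c x (w : 'rV[R]_n) : tangent x :=
  w *m jacobian (chart_at x \o chart_inv c) (c x).

Lemma coord_vectorE c i x : coord_vector c i x = chart_vector c x (delta_mx 0 i).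
Proof. by []. Qed.

(** Frees [tangent_map] from the chosen charts [chart_at]. Both sides are the derivative of [h],
    which reads [f] from [c] to the chosen chart at [f x]. *)
Lemma tangent_map_chart (f : M -> M) c c' x w : smooth_map f ->
  atlas c -> atlas c' -> chart_dom c x -> chart_dom c' (f x) ->
  tangent_map f (chart_vector c x w) =
    chart_vector c' (f x) (w *m jacobian (c' \o f \o chart_inv c) (c x)).
Proof.
move=> sf ac ac' dx dfx; rewrite /tangent_map /chart_vector.
pose h := chart_at (f x) \o f \o chart_inv c.
have aX := chart_at_atlas; have dX := chart_at_dom.
have dh : differentiable h (c x).
  by apply: smooth_map_differentiable.
have near_dom : \forall y \near c x, [/\ chart_dom c (chart_inv c y),
    (chart_dom (chart_at x) `&` f @^-1` chart_dom c') (chart_inv c y) &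
    c (chart_inv c y) = y].
  apply: nbhs_chart_img => //; apply: filterI; first exact: nbhs_chart_dom.
  by apply: (sf.1 x); exact: nbhs_chart_dom.
transitivity (w *m jacobian h (c x)).
  have E : (chart_at x \o chart_inv c) (c x) = chart_at x x.
    by rewrite /= chart_funK.
  rewrite -E; apply: jacobian_chain => //.
  - exact: chart_transition_differentiable.
  - by rewrite E; exact: smooth_map_differentiable.
  - by apply: filterS near_dom => y [d1 [d2 d3] _]; rewrite /h /= chart_funK.
have E : (c' \o f \o chart_inv c) (c x) = c' (f x) by rewrite /= chart_funK.
rewrite -E; apply/esym; apply: jacobian_chain => //.
- exact: smooth_map_differentiable.
- by rewrite E; exact: chart_transition_differentiable.
- by apply: filterS near_dom => y [d1 [d2 d3] _]; rewrite /h /= chart_funK.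
Qed.

Lemma chart_vector_at x (v : tangent x) : chart_vector (chart_at x) x v = v.
Proof.
have aX := chart_at_atlas; have dX := chart_at_dom.
rewrite /chart_vector mul_jacobian.
have d1 : differentiable (chart_at x \o chart_inv (chart_at x)) (chart_at x x).
  exact: chart_transition_differentiable.
rewrite -(deriveE v d1) -[RHS](@derive_id R _ (chart_at x x) v).
apply: near_eq_derive.
by apply: filterS (nbhs_chart_img (dX x) (nbhs_chart_dom (dX x))) => y [].
Qed.

(** The coordinate change from [chart_at x] back to [c] undoes the one defining [chart_vector]. *)
Lemma chart_vector_inj c x w : atlas c -> chart_dom c x ->
  chart_vector c x w = 0 :> 'rV[R]_n -> w = 0.
Proof.
move=> ac dx E.
have aX := chart_at_atlas; have dX := chart_at_dom.
have E1 : (chart_at x \o chart_inv c) (c x) = chart_at x x.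
  by rewrite /= chart_funK.
have d1 : differentiable (chart_at x \o chart_inv c) (c x).
  exact: chart_transition_differentiable.
have d2 : differentiable (c \o chart_inv (chart_at x))
    ((chart_at x \o chart_inv c) (c x)).
  by rewrite E1; exact: chart_transition_differentiable.
have H := @jacobian_chain R n n n _ _ (fun y => y) (c x) w d1 d2
  (rV_id_differentiable _) _.
have {H} : w *m jacobian (chart_at x \o chart_inv c) (c x) *m
    jacobian (c \o chart_inv (chart_at x)) ((chart_at x \o chart_inv c) (c x)) =
    w *m jacobian (fun y => y) (c x).
  apply: H; apply: filterS (nbhs_chart_img dx (nbhs_chart_dom (dX x))) => y.
  by move=> [e1 e2 e3]; rewrite /= chart_funK.
have E' : w *m jacobian (chart_at x \o chart_inv c) (c x) = 0 by exact: E.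
have did : w *m jacobian (fun y : 'rV[R]_n => y) (c x) = w.
  rewrite mul_jacobian -(deriveE w (rV_id_differentiable (c x))).
  exact: derive_id.
move=> H; apply: (etrans (esym did)); apply: (etrans (esym H)).
exact: etrans (congr1 (mulmx^~ _) E') (mul0mx _ _).
Qed.

Lemma tangent_map_comp (a b : M -> M) x (v : tangent x) :
  smooth_map a -> smooth_map b -> smooth_map (a \o b) ->
  tangent_map (a \o b) v = tangent_map a (tangent_map b v).
Proof.
move=> sa sb sab; rewrite -[v]chart_vector_at.
have aX := chart_at_atlas; have dX := chart_at_dom.
have H1 := tangent_map_chart v sab (aX x) (aX (a (b x))) (dX x) (dX (a (b x))).
have H2 := tangent_map_chart v sb (aX x) (aX (b x)) (dX x) (dX (b x)).
have H3 w := tangent_map_chart w sa (aX (b x)) (aX (a (b x))) (dX (b x))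
  (dX (a (b x))).
apply: (etrans H1); apply/esym.
apply: (etrans (congr1 (@tangent_map R n M a (b x)) H2)).
apply: (etrans (H3 _)); apply/esym.
apply: (congr1 (chart_vector (chart_at (a (b x))) (a (b x)))).
have E : (chart_at (b x) \o b \o chart_inv (chart_at x)) (chart_at x x) =
  chart_at (b x) (b x) by rewrite /= chart_funK.
rewrite -E; apply/esym; apply: jacobian_chain.
- exact: smooth_map_differentiable.
- by rewrite E; exact: smooth_map_differentiable.
- exact: smooth_map_differentiable.
have nb : nbhs x (b @^-1` chart_dom (chart_at (b x))).
  by apply: (sb.1 x); exact: nbhs_chart_dom.
apply: filterS (nbhs_chart_img (dX x) nb) => y [e1 e2 e3].
by rewrite /= chart_funK.
Qed.

End Charts.

Section MetricCoefficients.
Context {R : realType} {n : nat} {M : manifoldType R n}.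
Variable g : riemannian_metric M.
Implicit Types (c : chart R n M) (x : M).

Definition metric_coef c (p q : 'I_n) : 'rV[R]_n -> R :=
  (fun x => g x (coord_vector c p x) (coord_vector c q x)) \o chart_inv c.

Lemma metric_coefE c p q x : chart_dom c x ->
  metric_coef c p q (c x) = g x (coord_vector c p x) (coord_vector c q x).
Proof.
by move=> /chart_funK E; exact: (congr1 (fun x =>
  g x (coord_vector c p x) (coord_vector c q x)) E).
Qed.

Lemma metric_suml x (I : Type) (r : seq I) (a : I -> R) (v : I -> 'rV[R]_n)
    (w : tangent x) :
  g x (\sum_(i <- r) a i *: v i : 'rV[R]_n) w = \sum_(i <- r) a i * g x (v i) w.
Proof.
have L := @metric_linear _ _ _ g x w.
have L0 : g x (0 : 'rV[R]_n) w = 0.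
  by have := L (-1) 0 0; rewrite scaler0 addr0 mulN1r addNr.
elim: r => [|i r IH]; first by rewrite !big_nil.
by rewrite !big_cons -IH; exact: L.
Qed.

Lemma metric_sumr x (I : Type) (r : seq I) (a : I -> R) (v : I -> 'rV[R]_n)
    (w : tangent x) :
  g x w (\sum_(i <- r) a i *: v i : 'rV[R]_n) = \sum_(i <- r) a i * g x w (v i).
Proof.
by rewrite Defs.metric_sym metric_suml; apply: eq_bigr => i _; rewrite Defs.metric_sym.
Qed.

Lemma chart_vector_sum c x (u : 'rV[R]_n) :
  chart_vector c x u = \sum_p u 0 p *: (coord_vector c p x : 'rV[R]_n).
Proof.
rewrite /chart_vector [u in LHS]row_sum_delta mulmx_suml.
by apply: eq_bigr => p _; rewrite -scalemxAl.
Qed.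

Lemma metric_chart_vector c x (u : 'rV[R]_n) :
  g x (chart_vector c x u) (chart_vector c x u) =
    \sum_p \sum_q u 0 p * u 0 q * g x (coord_vector c p x) (coord_vector c q x).
Proof.
rewrite {1}chart_vector_sum metric_suml; apply: eq_bigr => p _.
rewrite chart_vector_sum metric_sumr mulr_sumr.
by apply: eq_bigr => q _; rewrite mulrA.
Qed.

Lemma coord_vector_neq0 c x p : atlas c -> chart_dom c x ->
  coord_vector c p x != 0 :> 'rV[R]_n.
Proof.
move=> ac dx; apply/eqP => /(chart_vector_inj ac dx)/matrixP/(_ 0 p).
by rewrite !mxE !eqxx /=; apply/eqP; rewrite oner_eq0.
Qed.

(** Evaluates a^*g = f g on the i-th coordinate vector, whose image has coordinates [J]. Only
    derivatives of [a] and coefficients of [g] occur, so regularity in a parameter of [a] can be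
    read off. *)
Lemma conformal_factor_chart (a : M -> M) (f : R) c c' x i : smooth_map a ->
  (forall v : tangent x, pullback a g v v = f * g x v v) ->
  atlas c -> atlas c' -> chart_dom c x -> chart_dom c' (a x) ->
  let J p := 'D_(delta_mx 0 i) (fun y => c' (a (chart_inv c y)) 0 p) (c x) in
  f = (\sum_p \sum_q J p * J q * metric_coef c' p q (c' (a x))) *
      (metric_coef c i i (c x))^-1.
Proof.
move=> sa pf ac ac' dx dax J.
have g0 : 0 < g x (coord_vector c i x) (coord_vector c i x).
  by apply: metric_pos; exact: coord_vector_neq0.
rewrite (metric_coefE _ _ dx).
have E2 p q := metric_coefE p q dax.
under eq_bigr do under eq_bigr do rewrite E2.
have := pf (coord_vector c i x); rewrite /pullback coord_vectorE.
rewrite (tangent_map_chart _ sa ac ac' dx dax) metric_chart_vector => H.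
apply: (mulIf (lt0r_neq0 g0)); rewrite divfK; last exact: lt0r_neq0.
apply: (etrans (esym H)); apply: eq_bigr => p _; apply: eq_bigr => q _.
have dh := smooth_map_differentiable sa ac ac' dx dax.
have JE r : J r =
    ((delta_mx 0 i : 'rV[R]_n) *m jacobian (c' \o a \o chart_inv c) (c x)) 0 r.
  by rewrite mul_jacobian -(deriveE _ dh) (derive_rV_coord _ _ dh).
exact: (congr2 (fun s t => s * t * _) (esym (JE p)) (esym (JE q))).
Qed.

End MetricCoefficients.

(** * Cutoff functions for proper actions *)

Section BumpFunctions.
Context {R : realType} {n : nat} {M : manifoldType R n}.
Implicit Types (c : chart R n M) (x : M) (U A K L : set M).

Lemma smooth_fun_continuous (f : M -> R) : smooth_fun f -> continuous f.
Proof.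
move=> sf x; have aX := chart_at_atlas x; have dX := chart_at_dom x.
set c := chart_at x.
have cont1 : {for c x, continuous (f \o chart_inv c)}.
  by apply: (Ck_on_continuous (sf c aX 0%N)); exists x.
apply: (@near_eq_continuous _ _ (fun y => (f \o chart_inv c) (c y))).
  by apply: filterS (nbhs_chart_dom dX) => y dy; rewrite /= chart_funK.
by apply: continuous_comp; [exact: chart_fun_continuous | exact: cont1].
Qed.

Lemma smooth_fun_cst (a : R) : smooth_fun (fun _ : M => a).
Proof. by move=> c ac k; exact: Ck_on_cst. Qed.

Lemma smooth_funD (f g : M -> R) : smooth_fun f -> smooth_fun g ->
  smooth_fun (fun x => f x + g x).
Proof.
move=> sf sg c ac k; have oc := @chart_img_open _ _ _ c.
exact: (Ck_onD oc (sf c ac k) (sg c ac k)).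
Qed.

Lemma smooth_fun_local (f : M -> R) : (forall x, exists U f',
  [/\ open U, U x, smooth_fun f' & forall y, U y -> f y = f' y]) -> smooth_fun f.
Proof.
move=> H c ac k; apply: Ck_on_local => _ [x dx <-].
have [U [f' [oU Ux sf' E]]] := H x.
have oI := chart_img_sub_open (c := c) oU.
exists (c @` (chart_dom c `&` U)); first by exists x.
apply: (Ck_on_ext oI) (Ck_on_sub _ (sf' c ac k)).
  by move=> y [z [dz Uz] <-]; rewrite /= chart_funK // E.
by move=> y [z [dz Uz] <-]; exists z.
Qed.

Lemma closed_ball_rV_compact (y : 'rV[R]_n) (r : R) :
  compact [set z | `|z - y| <= r].
Proof.
have -> : [set z | `|z - y| <= r] = closed_ball_ Num.norm y r.
  by apply/funext => z; rewrite /closed_ball_ /= distrC.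
apply: bounded_closed_compact; last exact: closed_closed_ball_.
exists (`|y| + r); split; first exact: num_real.
move=> N yrN z zr; apply: le_trans (ltW yrN).
by rewrite -[z](subrK y) addrC (le_trans (ler_normD _ _)) // lerD2l distrC.
Qed.

Lemma bump_function x U : nbhs x U -> exists (phi : M -> R) K,
  [/\ smooth_fun phi, forall y, 0 <= phi y, 0 < phi x, compact K /\ K `<=` U
    & forall y, ~ K y -> phi y = 0].
Proof.
move=> nU; have aX := chart_at_atlas x; have dX := chart_at_dom x.
set c := chart_at x.
have [r r0 Hr] := (nbhs0_normP _).1 (nbhs_shift0 (nbhs_chart_img dX nU)).
(* Half the radius keeps the closed ball inside the image of the chart, and its preimage inside
   [U]. *)
have r2 : 0 < r / 2 by rewrite divr_gt0.
pose B := [set z : 'rV[R]_n | `|z - c x| <= r / 2].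
have HB z : B z -> [/\ chart_dom c (chart_inv c z), U (chart_inv c z)
    & c (chart_inv c z) = z].
  move=> Bz; rewrite -[z](subrK (c x)); apply: Hr; apply: le_lt_trans Bz _.
  by rewrite ltr_pdivrMr // ltr_pMr // ltr1n.
pose K := chart_inv c @` B.
have cK : compact K.
  apply: continuous_compact; last exact: closed_ball_rV_compact.
  apply: continuous_in_subspaceT => z /set_mem /HB[d1 _ E].
  by rewrite -E; exact: chart_inv_continuous.
(* The Hausdorff axiom enters here: extension by 0 is smooth across the boundary of the chart domain
   because it vanishes on the open complement of [K]. *)
have clK : closed K by apply: compact_closed => //; exact: manifold_hausdorff.
pose phi y := if pselect (chart_dom c y) then bump_rV (c x) (r / 2) (c y) else 0.
have phiE y : chart_dom c y -> phi y = bump_rV (c x) (r / 2) (c y).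
  by rewrite /phi; case: pselect.
have phiK y : ~ K y -> phi y = 0.
  move=> nK; rewrite /phi; case: pselect => // dy; apply/eqP/negPn/negP => nz.
  apply: nK; exists (c y); last exact: chart_funK.
  exact: bump_rV_support nz.
exists phi, K; split => //.
- move=> c2 ac2 k; apply: Ck_on_local => _ [z dz <-].
  case: (pselect (chart_dom c z)) => [cz|ncz]; last first.
    have oK : open (~` K) by exact: closed_openC.
    have oI := chart_img_sub_open (c := c2) oK.
    exists (c2 @` (chart_dom c2 `&` ~` K)).
      exists z => //; split=> // -[y By E]; apply: ncz; rewrite -E.
      by have [] := HB y By.
    apply: (Ck_on_ext oI _ (@Ck_on_cst _ _ _ _ 0)) => y [w [dw nKw] <-].
    by rewrite /= chart_funK // phiK.
  have oc := @chart_dom_open _ _ _ c.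
  have oI := chart_img_sub_open (c := c2) oc.
  exists (c2 @` (chart_dom c2 `&` chart_dom c)); first by exists z.
  apply: (@Ck_on_ext _ _ _ _ (bump_rV (c x) (r / 2) \o (c \o chart_inv c2))) => //.
    by move=> y [w [dw cw] <-]; rewrite /= chart_funK // phiE.
  apply: (Ck_on_comp oI openT).
  + by [].
  + by move=> j; exact: (atlas_compatible _ _ ac2 aX j k).
  + move=> y [w [dw cw] <-]; apply: differentiable_continuous.
    exact: chart_transition_differentiable.
  exact: bump_rV_smooth.
- by move=> y; rewrite /phi; case: pselect => // dy; exact: bump_rV_ge0.
- by rewrite phiE //; exact: bump_rV_gt0.
by split=> // _ [z /HB[_ Uz _] <-].
Qed.

Lemma compact_bump_function L U : compact L -> open U -> L `<=` U ->
  exists (phi : M -> R) K,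
  [/\ smooth_fun phi, forall y, 0 <= phi y, forall x, L x -> 0 < phi x,
    compact K /\ K `<=` U & forall y, ~ K y -> phi y = 0].
Proof.
move=> cL oU LU.
apply: (compact_ind (P := fun A => exists (phi : M -> R) K,
  [/\ smooth_fun phi, forall y, 0 <= phi y, forall x, A x -> 0 < phi x,
    compact K /\ K `<=` U & forall y, ~ K y -> phi y = 0]) cL).
- exists (fun=> 0), set0; split => //; first exact: smooth_fun_cst.
  by split => //; exact: compact0.
- move=> A B AB [phi [K [s p0 pB [cK KU] pK]]]; exists phi, K; split => //.
  by move=> x /AB; exact: pB.
- move=> A B [phi [K [s p0 pA [cK KU] pK]]] [psi [K' [s' p0' pB [cK' KU'] pK']]].
  exists (fun x => phi x + psi x), (K `|` K'); split.
  + exact: smooth_funD.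
  + by move=> y; exact: addr_ge0.
  + by move=> x [/pA h|/pB h]; [exact: ltr_pwDl | exact: ltr_wpDl].
  + by split; [exact: compactU | move=> x [/KU|/KU']].
  + by move=> y /not_orP[/pK -> /pK' ->]; rewrite addr0.
move=> x /LU Ux.
have [phi [K [s p0 px cKU pK]]] := bump_function (open_nbhs_nbhs (conj oU Ux)).
exists [set y | 0 < phi y]; last by exists phi, K.
have cphi : phi y @[y --> x] --> phi x by exact: smooth_fun_continuous.
exact: (cphi _ (lt_nbhsr px)).
Qed.

Lemma compact_nbhs_exists x : exists2 K, compact K & nbhs x K.
Proof.
have [phi [K [s p0 px [cK _] pK]]] := bump_function (@filterT _ _ (nbhs_filter x)).
exists K => //; have cphi : phi y @[y --> x] --> phi x by exact: smooth_fun_continuous.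
have npos : nbhs x [set y | 0 < phi y] by exact: (cphi _ (lt_nbhsr px)).
apply: filterS npos => y /= py.
by apply: contrapT => /pK py0; rewrite py0 ltxx in py.
Qed.

Lemma compact_sub_interior K : compact K ->
  exists2 K', compact K' & K `<=` K'^°.
Proof.
move=> cK; apply: (compact_ind (P := fun A => exists2 K', compact K' & A `<=` K'^°)
  cK).
- by exists set0 => //; exact: compact0.
- by move=> A B AB [K' cK' BK']; exists K' => // x /AB /BK'.
- move=> A B [K1 c1 A1] [K2 c2 B2]; exists (K1 `|` K2); first exact: compactU.
  by move=> x [/A1 h|/B2 h]; apply: filterS h => y ?; [left | right].
move=> x _; have [K' cK' nK'] := compact_nbhs_exists x.
by exists K'^°; [exact: nbhs_interior | exists K'].
Qed.

(** By local compactness, the members of a countable basis that lie in some compact set still cover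
    M; [C i] is a compact set around the one numbered [i]. *)
Lemma sigma_compact : exists C : nat -> set M,
  (forall i, compact (C i)) /\ forall x, exists i, C i x.
Proof.
have [B /countable_injP[f finj] [oB nB]] := @manifold_second_countable R n M.
have H i : exists K, compact K /\
    forall b, B b -> f b = i -> (exists2 K', compact K' & b `<=` K') -> b `<=` K.
  have [[b [Bb fb [K cK bK]]]|no] := pselect (exists b, [/\ B b, f b = i &
      exists2 K, compact K & b `<=` K]).
    exists K; split=> // b' Bb' fb' _.
    suff -> : b' = b by [].
    by apply: finj; rewrite ?inE // fb fb'.
  exists set0; split; first exact: compact0.
  by move=> b Bb fb bK; case: no; exists b.
have [C HC] := choice H.
exists C; split=> [i|x]; first by have [] := HC i.
have [K cK nK] := compact_nbhs_exists x.
have [b [Bb bx] bK] := nB x _ nK.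
by exists (f b); exact: ((HC (f b)).2 b Bb erefl (ex_intro2 _ _ K cK bK) x bx).
Qed.

(** Starting from the empty set gives [K 0] an empty saturation, the base case of later arguments on
    orbits. *)
Lemma compact_exhaustion : exists K : nat -> set M,
  [/\ K 0%N = set0, forall i, compact (K i), forall i, K i `<=` (K i.+1)^°
    & forall x, exists i, K i x].
Proof.
have [C [cC coverC]] := sigma_compact.
have H (A : set M) : exists A', compact A -> compact A' /\ A `<=` A'^°.
  case: (pselect (compact A)) => [cA|nA]; last by exists set0.
  by have [A' cA' AA'] := compact_sub_interior cA; exists A'.
have [nxt Hnxt] := choice H.
pose K := fix K i := if i is i'.+1 then nxt (K i' `|` C i') else set0.
have cK i : compact (K i).
  elim: i => [|i IH]; first exact: compact0.
  by apply: (Hnxt _ _).1; exact: compactU.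
have KS i : K i `|` C i `<=` (K i.+1)^°.
  by apply: (Hnxt _ _).2; exact: compactU.
exists K; split=> // [i x Kx|x]; first by apply: KS; left.
have [i Cx] := coverC x; exists i.+1.
by apply: interior_subset; apply: KS; right.
Qed.

End BumpFunctions.

Lemma continuous_slice (X Y Z : topologicalType) (f : X * Y -> Z) (a : X) :
  continuous f -> continuous (fun y => f (a, y)).
Proof.
move=> cf y; have h : (a, z) @[z --> y] --> (a, y).
  exact: (cvg_pair (cvg_cst _) cvg_id).
exact: (cvg_comp _ _ h (cf (a, y))).
Qed.

Section ProperAction.
Context {R : realType} {n k : nat} {M : manifoldType R n} {G : lieGroupType R k}.
Variable act : G -> M -> M.
Hypotheses (act1 : act 1%g = id)
  (actM : forall a b, act (a * b)%g = act a \o act b)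
  (act_continuous : continuous (fun p : G * M => act p.1 p.2))
  (hproper : proper_action act).
Implicit Types (A K L S : set M) (x y : M) (a b : G).

Lemma actK a : cancel (act a) (act a^-1%g).
Proof. by move=> x; have := congr1 (@^~ x) (actM a^-1%g a); rewrite mulVg act1. Qed.

Lemma act_slice_continuous a : continuous (act a).
Proof.
exact: (@continuous_slice _ _ _ (fun p : G * M => act p.1 p.2) a).
Qed.

Definition saturation A : set M := [set x | exists a, A (act a x)].

Lemma saturation_act A a x : saturation A x -> saturation A (act a x).
Proof.
by move=> [b Ab]; exists (b * a^-1)%g; rewrite actM /= actK.
Qed.

Lemma saturation_open A : open A -> open (saturation A).
Proof.
move=> oA; rewrite openE => x [a Aax].
have nA : nbhs (act a x) A by exact: open_nbhs_nbhs.
have h : nbhs x [set y | A (act a y)] by exact: (@act_slice_continuous a x _ nA).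
by apply: filterS h => y Ay; exists a.
Qed.

(** The form in which properness is used: this set is the preimage of [S] x [L] under (a, x) |-> (a
    x, x). *)
Lemma return_compact S L : compact S -> compact L ->
  compact [set p : G * M | S (act p.1 p.2) /\ L p.2].
Proof.
move=> cS cL; have [_ /(_ (S `*` L))] := hproper; apply.
exact: compact_setX.
Qed.

(** In a compact neighbourhood [L] of the limit point, a point y with a y in [K] is the image of
    (a^-1, a y). Such pairs form a compact return set, so its image is compact, hence closed. *)
Lemma saturation_closed K : compact K -> closed (saturation K).
Proof.
move=> cK x clx; have [L cL nL] := compact_nbhs_exists x.
pose E := [set p : G * M | L (act p.1 p.2) /\ K p.2].
have cE : compact ((fun p : G * M => act p.1 p.2) @` E).
  apply: continuous_compact; last exact: return_compact.
  exact: continuous_subspaceT.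
have /(_ x) : closed ((fun p : G * M => act p.1 p.2) @` E).
  by apply: compact_closed => //; exact: manifold_hausdorff.
case.
  move=> B nB; have [y [[a Kay] [By Ly]]] := clx _ (filterI nB nL).
  exists y; split=> //; exists (a^-1%g, act a y); last by rewrite /= actK.
  by split=> //=; rewrite actK.
by move=> [a y] /= [_ Ky] <-; exists a^-1%g; rewrite actK.
Qed.

(* With an exhaustion K_i, bump functions f_i > 0 on the compact set
   K_(i+1) \ G int(K_i), supported away from G K_(i-1), have a sum that is
   locally finite on the orbits. *)
Lemma invariant_cutoff : exists phi : M -> R,
  [/\ smooth_fun phi, forall x, 0 <= phi x, forall x, exists a, 0 < phi (act a x)
    & forall x, exists L (C : set G), [/\ nbhs x L, compact C &
        forall y a, L y -> ~ C a -> phi (act a y) = 0]].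
Proof.
have [K [K0 cK KS coverK]] := @compact_exhaustion R n M.
have Kmono i j : (i <= j)%N -> K i `<=` K j.
  elim: j => [|j IH]; first by rewrite leqn0 => /eqP ->.
  rewrite leq_eqVlt => /predU1P[-> //|/IH ij] x /ij /KS; exact: interior_subset.
have sat_mono A B : A `<=` B -> saturation A `<=` saturation B.
  by move=> AB x [a /AB]; exists a.
(* The predecessor is harmless at 0: [K 0] is empty, so [U 0] is all of M. *)
pose U i := ~` saturation (K i.-1).
pose L i := K i.+1 `&` ~` saturation (K i)^°.
have oU i : open (U i) by apply: closed_openC; exact: saturation_closed.
have cL i : compact (L i).
  apply: compact_closedI => //; apply: open_closedC; apply: saturation_open.
  exact: open_interior.
have LU i : L i `<=` U i.
  move=> x [_ nx] /= sx; apply: nx; case: i sx => [|i] /=.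
    by rewrite K0 => -[].
  exact: sat_mono.
have H i : exists pS : (M -> R) * set M, [/\ smooth_fun pS.1,
    forall y, 0 <= pS.1 y, forall x, L i x -> 0 < pS.1 x,
    compact pS.2 /\ pS.2 `<=` U i & forall y, ~ pS.2 y -> pS.1 y = 0].
  by have [phi [S h]] := compact_bump_function (cL i) (oU i) (@LU i); exists (phi, S).
have [pS HpS] := choice H.
pose f i := (pS i).1; pose S i := (pS i).2.
have f_ge0 i x : 0 <= f i x by have [_ h _ _ _] := HpS i; exact: h.
have f0 i j x : saturation (K j) x -> (j < i)%N -> f i x = 0.
  move=> sx; case: i => // i ji; have [_ _ _ [_ SU] h] := HpS i.+1.
  by apply: h => Sx; exact: (SU _ Sx (sat_mono _ _ (Kmono j i ji) _ sx)).
have stable j m x : saturation (K j) x -> (j < m)%N ->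
    \sum_(i < m) f i x = \sum_(i < j.+1) f i x.
  move=> sx; elim: m => // m IH; rewrite ltnS leq_eqVlt => /predU1P[-> //|jm].
  by rewrite big_ord_recr /= (f0 _ _ _ sx jm) addr0 IH.
(* On G K_j only f_0, ..., f_j survive, so the sum may be cut at any index whose compact set meets
   the orbit; [N x] is one. *)
have [N HN] := choice coverK.
pose phi x := \sum_(i < (N x).+1) f i x.
have sat_K j x : K j x -> saturation (K j) x by exists 1%g; rewrite act1.
have phiE j x : saturation (K j) x -> phi x = \sum_(i < j.+1) f i x.
  move=> sx; rewrite /phi.
  rewrite -(stable j (maxn j (N x)).+1 x sx); last by rewrite ltnS leq_maxl.
  by rewrite -(stable (N x) (maxn j (N x)).+1 x (sat_K _ _ (HN x))) // ltnS leq_maxr.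
exists phi; split.
- apply: smooth_fun_local => x.
  exists (K (N x).+1)^°, (fun y => \sum_(i < (N x).+2) f i y); split.
  + exact: open_interior.
  + by apply: KS; exact: HN.
  + elim: (N x).+2 => [|m IH].
      by under eq_fun do rewrite big_ord0; exact: smooth_fun_cst.
    under eq_fun do rewrite big_ord_recr; apply: smooth_funD => //.
    by have [] := HpS m.
  by move=> y Ky; apply: phiE; apply: sat_K; exact: interior_subset.
- by move=> x; apply: sumr_ge0 => i _; exact: f_ge0.
- move=> x.
  (* At this [i] the orbit meets [K i.+1] but not [K i], so some a x lies in [L i]. *)
  have [i [nx [a Kax]]] : exists i, ~ saturation (K i) x /\ saturation (K i.+1) x.
    elim: (N x) (sat_K _ _ (HN x)) => [[a]|i IH six]; first by rewrite K0.
    by case: (pselect (saturation (K i) x)) => [/IH//|nx]; exists i.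
  exists a; have [_ _ fL _ _] := HpS i.
  have fi : 0 < f i (act a x).
    apply: fL; split=> // sx; apply: nx.
    have := sat_mono _ _ (@interior_subset _ (K i)) _ sx.
    by move=> /(saturation_act a^-1%g); rewrite actK.
  rewrite (phiE i.+1); last exact: sat_K.
  rewrite (bigD1 (Ordinal (ltnW (ltnSn i.+1)))) //= ltr_pwDl //.
  by apply: sumr_ge0 => j _; exact: f_ge0.
(* For y in [K m], phi(a y) <> 0 forces a y into the union [T] of the first compact sets [S i]; such
   pairs (a, y) form a compact return set. *)
move=> x; pose m := (N x).+1.
pose T := \big[setU/set0]_(i < m.+1) S i.
have cT : compact T.
  rewrite /T; elim: m.+1 => [|j IH]; first by rewrite big_ord0; exact: compact0.
  by rewrite big_ord_recr; apply: compactU => //; have [_ _ _ []] := HpS j.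
exists (K m), (fst @` [set p : G * M | T (act p.1 p.2) /\ K m p.2]); split.
- by apply: KS; exact: HN.
- apply: continuous_compact; last exact: return_compact.
  apply: continuous_subspaceT => p; exact: cvg_fst.
move=> y a Ky nC; rewrite (phiE m); last exact/saturation_act/sat_K.
apply: big1 => i _; have [_ _ _ _ h] := HpS i; apply: h => Si; apply: nC.
exists (a, y) => //; split=> //=.
by rewrite /T (bigD1 i) //=; left.
Qed.

End ProperAction.

(** * The invariant conformal metric *)

Section ProductCharts.
Context {R : realType} {n k : nat} {M : manifoldType R n} {G : lieGroupType R k}.
Variable act : G -> M -> M.
Hypothesis hsmooth : smooth_map2 act.
Variables (c1 : chart R k G) (c c' : chart R n M).
Hypotheses (ac1 : atlas c1) (ac : atlas c) (ac' : atlas c').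

(** Has the shape of the domain in [smooth_map2], so that smoothness of the action applies by
    conversion. *)
Definition act_dom : set 'rV[R]_(k + n) :=
  [set row_mx (c1 p.1) (c p.2) | p in
    [set p | [/\ chart_dom c1 p.1, chart_dom c p.2 &
                 chart_dom c' (act p.1 p.2)]]].

Definition act_chart (u : 'rV[R]_(k + n)) : 'rV[R]_n :=
  c' (act (chart_inv c1 (lsubmx u)) (chart_inv c (rsubmx u))).

Lemma act_cvg (T : Type) (F : set_system T) (u : T -> G) (v : T -> M) (a : G)
    (x : M) : Filter F -> u @ F --> a -> v @ F --> x ->
  act (u t) (v t) @[t --> F] --> act a x.
Proof.
move=> FF ua vx.
exact: (@cvg_comp _ _ _ (fun t => (u t, v t)) (fun p : G * M => act p.1 p.2)
  _ _ _ (cvg_pair ua vx) (hsmooth.1 (a, x))).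
Qed.

Lemma chart_inv_cvg m (N : manifoldType R m) (d : chart R m N) (T : Type)
    (F : set_system T) (u : T -> 'rV[R]_m) x : Filter F -> chart_dom d x ->
  u @ F --> d x -> chart_inv d (u t) @[t --> F] --> x.
Proof.
move=> FF dx ux.
have ci : chart_inv d y @[y --> d x] --> chart_inv d (d x).
  exact: (@chart_inv_continuous _ _ _ d x dx).
rewrite chart_funK // in ci; exact: (cvg_comp u (chart_inv d) ux ci).
Qed.

(** Openness is not part of [smooth_map2], and the calculus rules for [Ck_on] rely on it. *)
Lemma act_dom_open : open act_dom.
Proof.
rewrite openE => _ [[a x] /= [da dx dax] <-].
set u0 := row_mx (c1 a) (c x).
have cl : (fun u : 'rV[R]_(k + n) => lsubmx u) @ u0 --> c1 a.
  have := @cvg_lsubmx R k n _ (nbhs u0) id u0 (nbhs_filter u0) (fun _ h => h).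
  by rewrite row_mxKl.
have cr : (fun u : 'rV[R]_(k + n) => rsubmx u) @ u0 --> c x.
  have := @cvg_rsubmx R k n _ (nbhs u0) id u0 (nbhs_filter u0) (fun _ h => h).
  by rewrite row_mxKr.
have h1 : \forall u \near u0, [/\ chart_dom c1 (chart_inv c1 (lsubmx u)),
    chart_dom c1 (chart_inv c1 (lsubmx u)) &
    c1 (chart_inv c1 (lsubmx u)) = lsubmx u].
  exact: (cl _ (nbhs_chart_img da (nbhs_chart_dom da))).
have h2 : \forall u \near u0, [/\ chart_dom c (chart_inv c (rsubmx u)),
    chart_dom c (chart_inv c (rsubmx u)) &
    c (chart_inv c (rsubmx u)) = rsubmx u].
  exact: (cr _ (nbhs_chart_img dx (nbhs_chart_dom dx))).
have h3 := act_cvg (nbhs_filter u0) (chart_inv_cvg (nbhs_filter u0) da cl)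
  (chart_inv_cvg (nbhs_filter u0) dx cr).
have h4 : \forall u \near u0,
    chart_dom c' (act (chart_inv c1 (lsubmx u)) (chart_inv c (rsubmx u))).
  exact: (h3 _ (nbhs_chart_dom dax)).
apply: filterS2 (filterI h1 h2) h4 => u [[e1 _ e2] [e3 _ e4]] e5.
exists (chart_inv c1 (lsubmx u), chart_inv c (rsubmx u)) => //=.
by rewrite e2 e4 hsubmxK.
Qed.

Lemma act_chartE a x : chart_dom c1 a -> chart_dom c x ->
  act_chart (row_mx (c1 a) (c x)) = c' (act a x).
Proof. by move=> da dx; rewrite /act_chart row_mxKl row_mxKr !chart_funK. Qed.

Lemma act_chart_smooth l j : Ck_on l act_dom (fun u => act_chart u 0 j).
Proof. exact: (hsmooth.2 _ _ _ ac1 ac ac' j l). Qed.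

Lemma act_chart_continuous u : act_dom u -> {for u, continuous act_chart}.
Proof.
move=> du.
apply: (@cvg_rV R n _ (nbhs u) act_chart (act_chart u) (nbhs_filter u)) => j.
exact: (Ck_on_continuous (act_chart_smooth 0 j) du).
Qed.

Lemma act_chart_comp_smooth l (f : 'rV[R]_n -> R) :
  smooth_fun_on (c' @` chart_dom c') f -> Ck_on l act_dom (f \o act_chart).
Proof.
move=> sf; apply: (Ck_on_comp act_dom_open (@chart_img_open _ _ _ c')).
- move=> _ [[a x] /= [da dx dax] <-]; rewrite act_chartE //.
  by exists (act a x).
- by move=> j; exact: act_chart_smooth.
- exact: act_chart_continuous.
exact: sf.
Qed.

Lemma rsubmx_comp_smooth l (f : 'rV[R]_n -> R) :
  smooth_fun_on (c @` chart_dom c) f ->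
  Ck_on l act_dom (fun u => f (rsubmx u)).
Proof.
move=> sf; apply: (Ck_on_comp act_dom_open (@chart_img_open _ _ _ c)).
- by move=> _ [[a x] /= [da dx dax] <-]; rewrite row_mxKr; exists x.
- move=> j; have -> : (fun u : 'rV[R]_(k + n) => rsubmx u 0 j) =
    (fun u => u 0 (rshift k j)) by apply/funext => u; rewrite mxE.
  exact: Ck_on_coord.
- move=> u _.
  exact: (@cvg_rsubmx R k n _ (nbhs u) id u (nbhs_filter u) (fun _ h => h)).
exact: sf.
Qed.

Lemma derive_act_chart a x i p : chart_dom c1 a ->
  'D_(delta_mx 0 i) (fun y => c' (act a (chart_inv c y)) 0 p) (c x) =
  'D_(delta_mx 0 (rshift k i)) (fun u => act_chart u 0 p) (row_mx (c1 a) (c x)).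
Proof.
move=> da; rewrite -(derive_row_mx _ _ _ _).2; congr ('D__ _ _).
by apply/funext => y; rewrite /act_chart row_mxKl row_mxKr chart_funK.
Qed.

End ProductCharts.

Section ConformalFactors.
Context {R : realType} {n k : nat} {M : manifoldType R n} {G : lieGroupType R k}.
Variables (g : riemannian_metric M) (act : G -> M -> M) (i0 : 'I_n).
Hypothesis hG : subgroup_via act (Conf g).
Hypothesis hsmooth : smooth_map2 act.
Implicit Types (a b : G) (x : M) (c : chart R n M).

Let actM a b : act (a * b)%g = act a \o act b.
Proof. by have [_ _ h _] := hG. Qed.

Let act_smooth a : smooth_map (act a).
Proof. by have [_ _ _ /(_ a) [[h _] _]] := hG. Qed.

Lemma conformal_factors : exists F : G -> M -> R, (forall a x, 0 < F a x) /\
  forall a x (v w : tangent x), pullback (act a) g v w = F a x * g x v w.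
Proof.
have H a : exists f : M -> R, (forall x, 0 < f x) /\
    forall x (v w : tangent x), pullback (act a) g v w = f x * g x v w.
  by have [_ _ _ /(_ a) [_ [f [_ f0] E]]] := hG; exists f.
by have [F HF] := choice H; exists F; split=> a; have [] := HF a.
Qed.

Variable F : G -> M -> R.
Hypothesis F_gt0 : forall a x, 0 < F a x.
Hypothesis F_pullback : forall a x (v w : tangent x),
  pullback (act a) g v w = F a x * g x v w.

(** The chain rule gives (ab)^*g = b^*(a^*g); evaluating on one nonzero vector and cancelling leaves
    the factors. Such a vector exists because [i0] makes the dimension positive. *)
Lemma conformal_factor_cocycle a b x : F (a * b)%g x = F a (act b x) * F b x.
Proof.
have ac := chart_at_atlas x; have dx := chart_at_dom x.
pose v := coord_vector (chart_at x) i0 x.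
have g0 : 0 < g x v v by apply: metric_pos; exact: coord_vector_neq0.
apply: (mulIf (lt0r_neq0 g0)); rewrite -(F_pullback (a * b)%g v v).
rewrite -mulrA -(F_pullback b v v) -(F_pullback a).
rewrite /pullback actM.
have sab : smooth_map (act a \o act b) by rewrite -actM.
by rewrite (tangent_map_comp v (act_smooth a) (act_smooth b) sab).
Qed.

(** Near each pair of a group element and a point, the factor is replaced by the formula of
    [conformal_factor_chart], read in product coordinates. *)
Lemma weighted_factor_Ck_param (phi : M -> R) c l : smooth_fun phi -> atlas c ->
  Ck_param l [set p : G * 'rV[R]_n | (c @` chart_dom c) p.2]
    (fun a y => phi (act a (chart_inv c y)) * F a (chart_inv c y)).
Proof.
move=> sphi ac; apply: Ck_param_local => -[a0 y0] /= [x0 dx0 E0].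
set c1 := chart_at a0; set c' := chart_at (act a0 x0).
have ac1 : atlas c1 := chart_at_atlas a0.
have ac' : atlas c' := chart_at_atlas _.
(* The region where [c1], [c] and [c'] all apply, so that the coordinate formula is valid. *)
pose Q := [set p : G * 'rV[R]_n | [/\ chart_dom c1 p.1, (c @` chart_dom c) p.2 &
  chart_dom c' (act p.1 (chart_inv c p.2))]].
have oQ : open Q.
  rewrite openE => -[a y] [/= da [x dx xy] dax].
  have n1 : \forall p \near (a, y), chart_dom c1 p.1.
    exact: (@cvg_fst _ _ (nbhs a) (nbhs y) _ _ (nbhs_chart_dom da)).
  have oc := @chart_img_open _ _ _ c.
  have ny : nbhs y (c @` chart_dom c).
    by apply: open_nbhs_nbhs; split=> //; exists x.
  have n2 : \forall p \near (a, y), (c @` chart_dom c) p.2.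
    exact: (@cvg_snd _ _ (nbhs a) (nbhs y) _ _ ny).
  have cy : (fun p : G * 'rV[R]_n => p.2) @ (a, y) --> c x.
    by rewrite xy; exact: cvg_snd.
  have ca : (fun p : G * 'rV[R]_n => p.1) @ (a, y) --> a by exact: cvg_fst.
  have h3 := act_cvg hsmooth (nbhs_filter (a, y)) ca
    (chart_inv_cvg (nbhs_filter (a, y)) dx cy).
  rewrite -xy chart_funK // in dax.
  have n3 : \forall p \near (a, y), chart_dom c' (act p.1 (chart_inv c p.2)).
    exact: (h3 _ (nbhs_chart_dom dax)).
  by apply: filterS2 (filterI n1 n2) n3 => p [].
have QE a y : Q (a, y) -> exists x, [/\ y = c x, chart_dom c1 a, chart_dom c x &
    chart_dom c' (act a x)].
  move=> [/= da [x dx xy]]; rewrite -xy chart_funK // => dax.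
  by exists x.
exists Q.
  rewrite /Q /= -E0 chart_funK //; split; [exact: chart_at_dom | by exists x0 |].
  exact: chart_at_dom.
pose theta := act_chart act c1 c c'.
(* Differentiates along the manifold block, with the group block fixed. *)
pose J p u := 'D_(delta_mx 0 (rshift k i0)) (fun u => theta u 0 p) u.
pose Psi u := (phi \o chart_inv c') (theta u) *
  ((\sum_p \sum_q J p u * J q u * (metric_coef g c' p q \o theta) u) *
   (metric_coef g c i0 i0 (rsubmx u))^-1).
apply: (@Ck_param_row_mx R n G k l (act_dom act c1 c c') Q c1 _ Psi) => //.
- by move=> [a y] [da _ _]; exact: chart_fun_continuous.
- move=> [a y] /QE[x [-> da dx dax]]; by exists (a, x).
- move=> [a y] /QE[x [-> da dx dax]].
  have thetaE : theta (row_mx (c1 a) (c x)) = c' (act a x) by exact: act_chartE.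
  rewrite /Psi /= thetaE !chart_funK // row_mxKr; congr (_ * _).
  rewrite (conformal_factor_chart i0 (act_smooth a) (fun v => F_pullback a v v)
    ac ac' dx dax).
  congr (_ * _); apply: eq_bigr => p _; apply: eq_bigr => q _; congr (_ * _).
  by rewrite !(derive_act_chart act c c' x i0 _ da).
have oU := @act_dom_open _ _ _ _ _ _ hsmooth c1 c c'.
have CJ p : Ck_on l (act_dom act c1 c c') (J p).
  by apply: Ck_on_partial; exact: (act_chart_smooth hsmooth ac1 ac ac').
have sg d p q : atlas d -> smooth_fun_on (d @` chart_dom d) (metric_coef g d p q).
  by move=> ad; exact: metric_smooth.
apply: (Ck_onM oU).
  exact: (act_chart_comp_smooth hsmooth ac1 ac ac' _ (sphi c' ac')).
apply: (Ck_onM oU).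
  apply: (Ck_on_sum _ oU) => p; apply: (Ck_on_sum _ oU) => q.
  apply: (Ck_onM oU); first exact: (Ck_onM oU).
  exact: (act_chart_comp_smooth hsmooth ac1 ac ac' _ (sg c' p q ac')).
apply: (Ck_onV oU).
  move=> _ [[a x] /= [da dx dax] <-]; rewrite row_mxKr (metric_coefE _ _ _ dx).
  by apply: lt0r_neq0; apply: metric_pos; exact: coord_vector_neq0.
by apply: (rsubmx_comp_smooth hsmooth); exact: sg.
Qed.

Hypothesis hproper : proper_action act.

Lemma invariant_conformal_weight : exists v : M -> R,
  smooth_pos v /\ forall b x, v (act b x) * F b x = v x.
Proof.
have act1 : act 1%g = id by have [] := hG.
have [phi [sphi phi_ge0 phi_gt0 phi_loc]] :=
  invariant_cutoff act1 actM hsmooth.1 hproper.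
have [I [IB IZ Ipos Itr Ibd]] := @haar_functional R k G.
pose psi x a := phi (act a x) * F a x.
(* One compact set [C] of contributing group elements serves all points near [x], as differentiation
   under [I] requires. *)
have loc c x : atlas c -> chart_dom c x -> exists W (C : set G),
    [/\ open W, W (c x), W `<=` c @` chart_dom c, compact C &
      forall a y, ~ C a -> W y -> psi (chart_inv c y) a = 0].
  move=> ac dx; have [L [C [nL cC LC]]] := phi_loc x.
  exists (c @` (chart_dom c `&` L^°)), C; split => //.
  - exact/chart_img_sub_open/open_interior.
  - by exists x.
  - by move=> y [z [dz _] <-]; exists z.
  move=> a y nCa [z [dz Lz] <-]; rewrite /psi chart_funK // LC ?mul0r //.
  exact: interior_subset Lz.
have Cpsi x : Cc (psi x).
  have ac := chart_at_atlas x; have dx := chart_at_dom x.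
  have [W [C [oW Wx Wc cC WC]]] := loc _ _ ac dx; split; last first.
    by exists C => // a nC; have := WC a _ nC Wx; rewrite chart_funK.
  move=> a.
  have h := Ck_param_continuous (weighted_factor_Ck_param 0 sphi ac)
    (Wc _ Wx : [set p : G * 'rV[R]_n | _ p.2] (a, chart_at x x)).
  have -> : psi x = (fun b => psi (chart_inv (chart_at x) (chart_at x x)) b).
    by rewrite chart_funK.
  have hp : (b, chart_at x x) @[b --> a] --> (a, chart_at x x).
    exact: (cvg_pair cvg_id (cvg_cst _)).
  exact: (cvg_comp _ _ hp h).
exists (fun x => I (psi x)); split; [split|].
- move=> c ac l; apply: Ck_on_local => _ [x dx <-].
  have [W [C [oW Wx Wc cC WC]]] := loc _ _ ac dx; exists W => //.
  apply: (@functional_Ck R n G I IB IZ Ibd C W cC oW l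
    (fun a y => psi (chart_inv c y) a)) => //.
  apply: Ck_param_sub (weighted_factor_Ck_param l sphi ac) => p Wp; exact: Wc.
- move=> x; have [a pa] := phi_gt0 x; apply: (Ipos _ a) => // [b|].
    by rewrite mulr_ge0 // ltW.
  exact: mulr_gt0.
(* By the cocycle identity psi(b x)(a) F(b, x) = psi(x)(a b), and right invariance removes [b]. *)
move=> b x; rewrite mulrC -IZ // -(Itr (psi x) b) //; congr (I _).
apply/funext => a; rewrite /psi actM /= conformal_factor_cocycle.
by rewrite mulrC -mulrA.
Qed.

End ConformalFactors.

Section RescaledMetric.
Context {R : realType} {n : nat} {M : manifoldType R n}.
Variables (g : riemannian_metric M) (v : M -> R).
Hypothesis hv : smooth_pos v.

Lemma rescale_sym x (u w : tangent x) : v x * g x u w = v x * g x w u.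
Proof. by rewrite Defs.metric_sym. Qed.

Lemma rescale_linear x (w : tangent x) :
  scalar (fun u : 'rV[R]_n => v x * g x u w).
Proof.
move=> a u u'; rewrite (@metric_linear _ _ _ g x w a u u').
by rewrite mulrDr mulrCA.
Qed.

Lemma rescale_pos x (u : tangent x) : u != 0 :> 'rV[R]_n -> 0 < v x * g x u u.
Proof. by move=> u0; rewrite mulr_gt0 ?hv.2 //; exact: metric_pos. Qed.

Lemma rescale_smooth (c : chart R n M) : atlas c -> forall i j : 'I_n,
  smooth_fun_on (c @` chart_dom c)
    ((fun x => v x * g x (coord_vector c i x) (coord_vector c j x))
       \o chart_inv c).
Proof.
move=> ac i j l; apply: (Ck_onM (@chart_img_open _ _ _ c)).
  exact: hv.1.
exact: metric_smooth.
Qed.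

Definition rescaled_metric : riemannian_metric M :=
  RiemannianMetric rescale_sym rescale_linear rescale_pos rescale_smooth.

End RescaledMetric.

Theorem theorem28 (R : realType) (n k : nat) (M : manifoldType R n)
  (g : riemannian_metric M) (G : lieGroupType R k) (act : G -> M -> M)
  (hG : subgroup_via act (Conf g))
  (hsmooth : smooth_map2 act)
  (hproper : proper_action act) :
  exists h : riemannian_metric M,
    conformal_to h g /\ subgroup_via act (Iso h).
Proof.
have [act_inj act1 actM act_conf] := hG.
have [F [F_gt0 F_pullback]] := conformal_factors hG.
(* Multiplying the equation by [g x u w] lets it hold in dimension 0 as well, where the positive
   factor [F] is arbitrary but all values of [g] are 0. *)
have [v [hv vE]] : exists v : M -> R, smooth_pos v /\
    forall b x (u w : tangent x), v (act b x) * F b x * g x u w = v x * g x u w.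
  case: (posnP n) => [n0|n_gt0].
    exists (fun=> 1); split; first by split=> // ; exact: smooth_fun_cst.
    move=> b x u w; suff -> : g x u w = 0 by rewrite !mulr0.
    have u0 : u = 0 :> 'rV[R]_n by apply/rowP => -[i i_lt]; exfalso; rewrite n0 in i_lt.
    have := @metric_suml R n M g x 'I_n [::] (fun=> 0) (fun=> 0) w.
    by rewrite !big_nil u0.
  have [v [hv vE]] := invariant_conformal_weight (Ordinal n_gt0) hG hsmooth
    F_gt0 F_pullback hproper.
  by exists v; split=> // b x u w; rewrite vE.
exists (rescaled_metric g hv); split; first by exists v.
split=> // b; split; first by have [] := act_conf b.
move=> x u w; rewrite -[RHS]/(v x * g x u w) -(vE b) -mulrA -F_pullback.
by [].
Qed.
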